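(* Let $(M,\omega)$ be a connected symplectic manifold (open or closed). Let either $k=3$ and $X,Y,Z\subset M$ be compact subsets with $X\cap Y\cap Z=\emptyset$, in which case put $p=pb_3(X,Y,Z)$ and $\mathcal F_k^\flat=\mathcal F_3^\flat(X,Y,Z)$; or $k=4$ and $X_0,X_1,Y_0,Y_1\subset M$ be compact subsets with $X_0\cap X_1=Y_0\cap Y_1=\emptyset$, in which case put $p=pb_4(X_0,X_1,Y_0,Y_1)$ and $\mathcal F_k^\flat=\mathcal F_4^\flat(X_0,X_1,Y_0,Y_1)$. (i) If $p=0$, then for every $s>0$ there exists $(F,G)\in\mathcal F_k^\flat$ with $\rho_{F,G}(s)=0$. (ii) If $p>0$, then for every $(F,G)\in\mathcal F_k^\flat$ the profile function $\rho_{F,G}$ is continuous, $\rho_{F,G}(0)=1/2$, and $$\frac12-\frac{1}{2\|\{F,G\}\|}\,s\ \ge\ \rho_{F,G}(s)\qquad\forall s\in[0,\|\{F,G\}\|].$$ Furthermore, if $k=3$ then $$\rho_{F,G}(s)\ge\frac12-\frac{1}{2\sqrt p}\sqrt s\qquad\forall (F,G)\in\mathcal F_3^\flat,\ \forall s\ge 0,$$ and if $k=4$ then $$\rho_{F,G}(s)\ge\frac12-\frac{1}{2p}\,s\qquad\forall (F,G)\in\mathcal F_4^\flat,\ \forall s\ge 0.$$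
   Context: $C^\infty_c(M)$ is the space of smooth compactly supported real functions on $M$ with the norm $\|F\|=\max_M|F|$; $\mathcal F=C_c^\infty(M)\times C_c^\infty(M)$ carries the distance $d((F,G),(H,K))=\|F-H\|+\|G-K\|$. The Hamiltonian vector field of $F$ is given by $i_{\mathrm{sgrad}F}\,\omega=-dF$ and $\{F,G\}=\omega(\mathrm{sgrad}\,G,\mathrm{sgrad}\,F)$. For $s\ge 0$ let $\mathcal K_s=\{(H,K)\in\mathcal F:\|\{H,K\}\|\le s\}$. The profile function of $(F,G)\in\mathcal F$ is $\rho_{F,G}:[0,+\infty)\to\mathbb R$, $\rho_{F,G}(s)=d((F,G),\mathcal K_s)=\inf_{(H,K)\in\mathcal K_s}d((F,G),(H,K))$. $\mathcal F_3(X,Y,Z)$ is the set of $(F,G)\in\mathcal F$ with $F|_X\le 0$, $G|_Y\le 0$, $(F+G)|_Z\ge 1$, and $pb_3(X,Y,Z)=\inf_{\mathcal F_3(X,Y,Z)}\|\{F,G\}\|$. $\mathcal F_4(X_0,X_1,Y_0,Y_1)$ is the set of $(F,G)\in\mathcal F$ with $F|_{X_0}\le 0$, $F|_{X_1}\ge 1$, $G|_{Y_0}\le 0$, $G|_{Y_1}\ge 1$, and $pb_4(X_0,X_1,Y_0,Y_1)=\inf_{\mathcal F_4(X_0,X_1,Y_0,Y_1)}\|\{F,G\}\|$. $\mathcal F_3^\flat\subset\mathcal F_3$ and $\mathcal F_4^\flat\subset\mathcal F_4$ are the subsets of those pairs $(F,G)$ for which at least one of the functions $F$, $G$ takes all its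 values in $[0,1]$. *)

(* Defs.v *)
From mathcomp Require Import all_boot all_order all_algebra.
From mathcomp Require Import all_classical all_reals all_analysis.
Set Implicit Arguments.
Unset Strict Implicit.
Unset Printing Implicit Defensive.
Import Order.TTheory GRing.Theory Num.Theory.
Import numFieldNormedType.Exports.
Local Open Scope classical_set_scope.
Local Open Scope ring_scope.

(* Only used for open A and finite-dimensional U: there, the differential of f
   is C^k if and only if all the directional derivatives of f are C^k. *)
Fixpoint Ck_on (R : realType) (U W : normedModType R) (A : set U) (k : nat)
    (f : U -> W) : Prop :=
  match k with
  | 0 => forall x, A x -> {for x, continuous f}
  | k'.+1 => (forall x, A x -> differentiable f x) /\
             (forall v, Ck_on A k' ('D_v f))
  end.

Definition smooth_on (R : realType) (U W : normedModType R) (A : set U)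
    (f : U -> W) : Prop :=
  forall k, Ck_on A k f.

(* [cmap] and [cinv] are total functions, but only the restrictions of [cmap]
   to [cdom] and of [cinv] to [cmap @` cdom] are meaningful. *)
Record chart (R : realType) (m : nat) (M : topologicalType) := Chart {
  cdom : set M;
  cmap : M -> 'rV[R]_m;
  cinv : 'rV[R]_m -> M;
  cdom_open : open cdom;
  cimg_open : open (cmap @` cdom);
  cmapK : forall p, cdom p -> cinv (cmap p) = p;
  cmap_continuous : forall p, cdom p -> {for p, continuous cmap};
  cinv_continuous : forall x, (cmap @` cdom) x -> {for x, continuous cinv}
}.

Definition cimg (R : realType) (m : nat) (M : topologicalType)
    (c : chart R m M) : set 'rV[R]_m :=
  cmap c @` cdom c.

Definition transition (R : realType) (m : nat) (M : topologicalType)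
    (c d : chart R m M) : 'rV[R]_m -> 'rV[R]_m :=
  cmap d \o cinv c.

Definition overlap (R : realType) (m : nat) (M : topologicalType)
    (c d : chart R m M) : set 'rV[R]_m :=
  cmap c @` (cdom c `&` cdom d).

(* A smooth m-dimensional manifold structure without boundary on M. The atlas
   need not be maximal; [chart_at p] is a chosen chart around p. *)
Record smooth_manifold (R : realType) (m : nat) (M : topologicalType) :=
  SmoothManifold {
  hausdorffM : hausdorff_space M;
  second_countableM : @second_countable M;
  atlas : set (chart R m M);
  chart_at : M -> chart R m M;
  chart_at_atlas : forall p, atlas (chart_at p);
  chart_at_dom : forall p, cdom (chart_at p) p;
  transition_smooth : forall c d, atlas c -> atlas d ->
    smooth_on (overlap c d) (transition c d)
}.

Definition bilin (R : realType) (m : nat) (A : 'M[R]_m) (u v : 'rV[R]_m) : R :=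
  (u *m A *m v^T) 0 0.

(* A 2-form is given by its coordinate expressions in the charts c of the atlas:
   at x in [cimg c] it is the bilinear form of matrix [omega c x], and these
   expressions are exchanged by pullback along the transition maps. In
   [omega_closed], u, v and w are constant vector fields, so that the bracket
   terms of d omega (u, v, w) vanish. *)
Record symplectic_form (R : realType) (m : nat) (M : topologicalType)
    (S : smooth_manifold R m M) := SymplecticForm {
  omega : chart R m M -> 'rV[R]_m -> 'M[R]_m;
  omega_smooth : forall c, atlas S c -> smooth_on (cimg c) (omega c);
  omega_pullback : forall c d, atlas S c -> atlas S d ->
    forall x, overlap c d x -> forall u v,
    bilin (omega c x) u v =
    bilin (omega d (transition c d x))
      ('D_u (transition c d) x) ('D_v (transition c d) x);
  omega_alternating : forall c, atlas S c -> forall x, cimg c x ->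
    forall v, bilin (omega c x) v v = 0;
  omega_nondegenerate : forall c, atlas S c -> forall x, cimg c x ->
    forall v, (forall u, bilin (omega c x) v u = 0) -> v = 0;
  omega_closed : forall c, atlas S c -> forall x, cimg c x -> forall u v w,
    'D_u (fun y => bilin (omega c y) v w) x
    - 'D_v (fun y => bilin (omega c y) u w) x
    + 'D_w (fun y => bilin (omega c y) u v) x = 0
}.

Section SymplecticManifold.
Variables (R : realType) (m : nat) (M : topologicalType).
Variables (S : smooth_manifold R m M) (w : symplectic_form S).
Implicit Types (F G H K : M -> R) (FG : (M -> R) * (M -> R)).

Definition smooth_fun F : Prop :=
  forall c, atlas S c -> smooth_on (cimg c) (F \o cinv c).

Definition compactly_supported F : Prop :=
  compact (closure [set p | F p != 0]).

Definition Cc_infty : set (M -> R) :=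
  [set F | smooth_fun F /\ compactly_supported F].

(* max_M |F| for F continuous with compact support. *)
Definition unorm F : R := sup (range (fun p => `|F p|)).

Definition FF : set ((M -> R) * (M -> R)) :=
  [set FG | Cc_infty FG.1 /\ Cc_infty FG.2].

Definition dist FG (HK : (M -> R) * (M -> R)) : R :=
  unorm (FG.1 \- HK.1) + unorm (FG.2 \- HK.2).

(* The coordinates, in the chart c and at the point of coordinates x, of the
   unique vector v such that omega(v, u) = - dF(u) for every u. *)
Definition sgrad (c : chart R m M) F (x : 'rV[R]_m) : 'rV[R]_m :=
  get [set v | forall u, bilin (omega w c x) v u = - 'D_u (F \o cinv c) x].

Definition poisson F G : M -> R := fun p =>
  let c := chart_at S p in
  let x := cmap c p in
  bilin (omega w c x) (sgrad c G x) (sgrad c F x).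

Definition KK (s : R) : set ((M -> R) * (M -> R)) :=
  [set HK | FF HK /\ unorm (poisson HK.1 HK.2) <= s].

Definition profile FG (s : R) : R := inf [set dist FG HK | HK in KK s].

Definition F3 (X Y Z : set M) : set ((M -> R) * (M -> R)) :=
  [set FG | [/\ FF FG,
    (forall p, X p -> FG.1 p <= 0),
    (forall p, Y p -> FG.2 p <= 0) &
    (forall p, Z p -> 1 <= FG.1 p + FG.2 p)]].

Definition F4 (X0 X1 Y0 Y1 : set M) : set ((M -> R) * (M -> R)) :=
  [set FG | FF FG /\ [/\
    (forall p, X0 p -> FG.1 p <= 0),
    (forall p, X1 p -> 1 <= FG.1 p),
    (forall p, Y0 p -> FG.2 p <= 0) &
    (forall p, Y1 p -> 1 <= FG.2 p)]].

(* The real-valued [inf] below is the infimum of a set that is bounded below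
   by 0; this set is nonempty for compact X, Y, Z with empty intersection
   (resp. compact X0, X1 disjoint and Y0, Y1 disjoint). *)
Definition pb3 (X Y Z : set M) : R :=
  inf [set unorm (poisson FG.1 FG.2) | FG in F3 X Y Z].

Definition pb4 (X0 X1 Y0 Y1 : set M) : R :=
  inf [set unorm (poisson FG.1 FG.2) | FG in F4 X0 X1 Y0 Y1].

Definition unit_valued F : Prop := forall p, 0 <= F p <= 1.

Definition F3flat (X Y Z : set M) : set ((M -> R) * (M -> R)) :=
  [set FG | F3 X Y Z FG /\ (unit_valued FG.1 \/ unit_valued FG.2)].

Definition F4flat (X0 X1 Y0 Y1 : set M) : set ((M -> R) * (M -> R)) :=
  [set FG | F4 X0 X1 Y0 Y1 FG /\ (unit_valued FG.1 \/ unit_valued FG.2)].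

End SymplecticManifold.

(* Main.v *)
Require Import Defs.
From mathcomp Require Import all_boot all_order all_algebra.
From mathcomp Require Import all_classical all_reals all_analysis.
From mathcomp Require Import ring lra.
Set Implicit Arguments.
Unset Strict Implicit.
Unset Printing Implicit Defensive.
Import Order.TTheory GRing.Theory Num.Theory.
Import numFieldNormedType.Exports.
Local Open Scope classical_set_scope.
Local Open Scope ring_scope.

(* If (H, K) has bracket at most s and lies at distances a, b from F, G, then soft
   thresholds of H - a and K - b, rescaled, satisfy the constraints defining pb_k;
   they multiply the bracket by at most the product of their slopes, which yields
   the lower bounds p (1 - 2a) (1 - 2b) <= s (k = 4) and p (1 - 2a - 2b)^2 <= s (k = 3).
   For the upper bound with 0 <= F <= 1, one moves F linearly towards a function H
   equal to 1/2 near the support of an approximation of G: the bracket decreases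
   linearly while the distance grows at most linearly to 1/2.
   Continuity at s > 0 follows by rescaling H, and at 0 from the lower bound.
   If p = 0, near minimizers are made unit-valued by smooth functions of F and G,
   which multiply the bracket by a bounded factor; as the infimum of the empty set
   is 0 here, this also needs the constraints to be satisfiable, i.e. bump functions. *)

(** * Smooth functions on open sets *)

(** For k = 4 the constraints impose a unit gap on each function. Moving F by a narrows its gap to 1
    - 2a, which may close at a = 1/2: this is where the constant 1/2 comes from. The two gaps are
    independent, so each cut has its own factor and the bound is linear in s. For k = 3 only the sum
    is controlled on Z, so both cuts need the common factor 1/(1 - 2a - 2b), and its square produces
    the square root of s. The thresholds are soft because admissible pairs must be smooth; the
    resulting loss d is removed in the limit. For the upper bound, an affine path works because its
    endpoint H commutes exactly with the approximation K of G: then {(1-t)F + tH, K} = (1-t){F, K}.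
    A zone around G = 0 on which K is constant leaves H room to drop from 1/2 to 0. All brackets are
    computed at a point by one Jacobian rule, once the bracket is known not to depend on the
    chart. *)

Section Smoothness.
Variables (R : realType) (U : normedModType R).

Lemma near_eq_differentiable (W : normedModType R) (f g : U -> W) (x : U) :
  (\near x, f x = g x) -> differentiable f x -> differentiable g x.
Proof.
move=> fg df; have [dfc fE] := (diff_locallyP _ _).1 df.
have gE : g \o shift x = cst (g x) + 'd f x +o_ 0 id.
  apply/eqaddoP => e e0; have /eqaddoP/(_ e e0) := fE.
  have fg0 : \forall h \near (0 : U), f (h + x) = g (h + x).
    by rewrite (near_shift x)/=; near=> h; rewrite /= sub0r subrK; near: h.
  apply: filter_app; near=> h.
  have E : f (h + x) = g (h + x) by near: h.
  by rewrite /= ![(_ - _) h]/= /= !fctE /= E (nbhs_singleton fg).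
apply/diff_locallyP.
have -> : 'd g x = 'd f x :> (U -> W) by exact: diff_unique.
by split.
Unshelve. all: by end_near. Qed.

Variable A : set U.
Hypothesis oA : open A.

(** Openness of [A] turns equality on [A] into equality of germs at its points, which is what
    derivatives see. *)
Lemma Ck_on_eq (W : normedModType R) k (f g : U -> W) :
  (forall x, A x -> f x = g x) -> Ck_on A k f -> Ck_on A k g.
Proof.
have nE (f1 g1 : U -> W) x : (forall x, A x -> f1 x = g1 x) -> A x -> \near x, f1 x = g1 x.
  by move=> fg Ax; apply: filterS (open_nbhs_nbhs (conj oA Ax)) => y; exact: fg.
elim: k f g => [|k IH] f g fg.
  move=> cf x Ax; have fx : f @ x --> g x by rewrite -(fg x Ax); exact: cf.
  by apply: cvg_trans fx; apply: near_eq_cvg; exact: nE.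
move=> [df cf]; split=> [x Ax|v]; first exact: near_eq_differentiable (nE _ _ _ fg Ax) (df x Ax).
by apply: IH (cf v) => x Ax; apply: near_eq_derive; exact: nE.
Qed.

Lemma Ck_onS (W : normedModType R) k (f : U -> W) : Ck_on A k.+1 f -> Ck_on A k f.
Proof.
elim: k f => [|k IH] f [df cf]; first by move=> x /df /differentiable_continuous.
by split=> // v; exact: IH.
Qed.

(** Meant for functions given by different formulas on different open pieces, such as bump functions
    extended by 0. *)
Lemma Ck_on_local (W : normedModType R) k (f : U -> W) :
  (forall x, A x -> exists B : set U, [/\ open B, B x & Ck_on B k f]) -> Ck_on A k f.
Proof.
elim: k f => [|k IH] f H; first by move=> x /H[B [_ Bx]]; exact.
split=> [x /H[B [_ Bx]] [+ _]|v]; first exact.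
by apply: IH => x /H[B [oB Bx [_ cf]]]; exists B; split=> //; exact: cf.
Qed.

Lemma smooth_on_differentiable (W : normedModType R) (f : U -> W) x :
  smooth_on A f -> A x -> differentiable f x.
Proof. by move=> /(_ 1%N)[+ _]; exact. Qed.

Lemma smooth_on_continuous (W : normedModType R) (f : U -> W) x :
  smooth_on A f -> A x -> {for x, continuous f}.
Proof. by move=> /(_ 0%N); exact. Qed.

Lemma smooth_onD (W : normedModType R) (f : U -> W) v :
  smooth_on A f -> smooth_on A ('D_v f).
Proof. by move=> sf k; have [_] := sf k.+1; exact. Qed.

Lemma smooth_on_eq (W : normedModType R) (f g : U -> W) :
  (forall x, A x -> f x = g x) -> smooth_on A f -> smooth_on A g.
Proof. by move=> fg sf k; apply: Ck_on_eq fg _. Qed.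

Lemma smooth_on_local (W : normedModType R) (f : U -> W) :
  (forall x, A x -> exists B : set U, [/\ open B, B x & smooth_on B f]) -> smooth_on A f.
Proof.
by move=> H k; apply: Ck_on_local => x /H[B [? ? ?]]; exists B; split.
Qed.

Lemma smooth_on_cst (W : normedModType R) (a : W) : smooth_on A (fun=> a).
Proof.
move=> k; elim: k a => [|k IH] a; first by move=> x _; exact: cvg_cst.
split=> [x _|v]; first exact: differentiable_cst.
by rewrite (_ : 'D_v _ = (fun=> 0)); [exact: IH|apply/funext => x; exact: derive_cst].
Qed.

Lemma smooth_on_id : smooth_on A (fun x : U => x).
Proof.
move=> [|k]; first by move=> x _.
split=> [x _|v]; first exact: (@ex_diff _ _ _ _ _ _ id).
apply: Ck_on_eq (smooth_on_cst v k) => x _.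
by rewrite (derive_id x v).
Qed.

Lemma Ck_on_add (W : normedModType R) k (f g : U -> W) :
  Ck_on A k f -> Ck_on A k g -> Ck_on A k (fun x => f x + g x).
Proof.
elim: k f g => [|k IH] f g; first by move=> cf cg x Ax; apply: cvgD; [exact: cf|exact: cg].
move=> [df cf] [dg cg]; split=> [x Ax|v].
  by apply: differentiableD; [exact: df|exact: dg].
apply: Ck_on_eq (IH _ _ (cf v) (cg v)) => x Ax /=.
by rewrite -deriveD//; apply: diff_derivable; [exact: df|exact: dg].
Qed.

Lemma Ck_on_mul k (f g : U -> R) :
  Ck_on A k f -> Ck_on A k g -> Ck_on A k (fun x => f x * g x).
Proof.
elim: k f g => [|k IH] f g; first by move=> cf cg x Ax; apply: cvgM; [exact: cf|exact: cg].
move=> Cf Cg; have [df cf] := Cf; have [dg cg] := Cg; split=> [x Ax|v].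
  by apply: differentiableM; [exact: df|exact: dg].
apply: Ck_on_eq (Ck_on_add (IH _ _ (Ck_onS Cf) (cg v)) (IH _ _ (Ck_onS Cg) (cf v))) => x Ax /=.
by rewrite -[LHS]deriveM//; apply: diff_derivable; [exact: df|exact: dg].
Qed.

Lemma smooth_on_add (W : normedModType R) (f g : U -> W) :
  smooth_on A f -> smooth_on A g -> smooth_on A (fun x => f x + g x).
Proof. by move=> sf sg k; exact: Ck_on_add. Qed.

Lemma smooth_on_mul (f g : U -> R) :
  smooth_on A f -> smooth_on A g -> smooth_on A (fun x => f x * g x).
Proof. by move=> sf sg k; exact: Ck_on_mul. Qed.

Lemma smooth_on_sum (I : Type) (s : seq I) (P : pred I) (f : I -> U -> R) :
  (forall i, P i -> smooth_on A (f i)) -> smooth_on A (fun x => \sum_(i <- s | P i) f i x).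
Proof.
move=> sf; elim: s => [|i s IH].
  by apply: smooth_on_eq (smooth_on_cst 0) => x _; rewrite big_nil.
have [Pi|nPi] := boolP (P i).
  by apply: smooth_on_eq (smooth_on_add (sf i Pi) IH) => x _; rewrite big_cons Pi.
by apply: smooth_on_eq IH => x _; rewrite big_cons (negbTE nPi).
Qed.

Lemma smooth_on_prod (I : Type) (s : seq I) (P : pred I) (f : I -> U -> R) :
  (forall i, P i -> smooth_on A (f i)) -> smooth_on A (fun x => \prod_(i <- s | P i) f i x).
Proof.
move=> sf; elim: s => [|i s IH].
  by apply: smooth_on_eq (smooth_on_cst (1 : R)) => x _; rewrite big_nil.
have [Pi|nPi] := boolP (P i).
  by apply: smooth_on_eq (smooth_on_mul (sf i Pi) IH) => x _; rewrite big_cons Pi.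
by apply: smooth_on_eq IH => x _; rewrite big_cons (negbTE nPi).
Qed.

Lemma smooth_on_coord m n (f : U -> 'M[R]_(m, n)) i j :
  smooth_on A f -> smooth_on A (fun x => f x i j).
Proof.
move=> sf k; move: f sf; elim: k => [|k IH] f sf.
  move=> x Ax; apply: (@continuous_comp _ _ _ f (fun N : 'M[R]_(m, n) => N i j)).
    exact: smooth_on_continuous Ax.
  exact: coord_continuous.
split=> [x Ax|v].
  apply: (@differentiable_comp _ _ _ _ f (fun N : 'M[R]_(m, n) => N i j)).
    exact: smooth_on_differentiable Ax.
  exact: differentiable_coord.
apply: Ck_on_eq (IH _ (smooth_onD v sf)) => x Ax.
rewrite derive_mx ?mxE//; apply: diff_derivable.
exact: smooth_on_differentiable Ax.
Qed.

End Smoothness.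

(** * Chain rule for smooth functions of one real variable *)

Section SmoothComp.
Variables (R : realType) (U : normedModType R) (A : set U).
Hypothesis oA : open A.

Lemma derive_comp1 (u : R -> R) (f : U -> R) x v :
  differentiable f x -> derivable u (f x) 1 ->
  'D_v (u \o f) x = u^`()%classic (f x) * 'D_v f x.
Proof.
move=> df /derivable1_diffP du.
rewrite !deriveE//; last exact: differentiable_comp.
by rewrite diff_comp//= diff1E// -[LHS]/(_ * _) mulrC.
Qed.

(** The chain rule gives a product with u' composed with f, so the induction on the order runs over
    all smooth [u] at once. *)
Lemma smooth_on_comp (u : R -> R) (f : U -> R) :
  smooth_on [set: R] u -> smooth_on A f -> smooth_on A (u \o f).
Proof.
move=> su sf k; elim: k u su => [|k IH] u su.
  move=> x Ax; apply: continuous_comp; first exact: smooth_on_continuous Ax.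
  exact: (@smooth_on_continuous _ _ setT).
split=> [x Ax|v].
  apply: differentiable_comp; first exact: smooth_on_differentiable Ax.
  exact: (@smooth_on_differentiable _ _ setT).
have C := Ck_on_mul oA (IH _ (smooth_onD (1 : R) su)) (smooth_onD v sf k).
apply: (Ck_on_eq oA _ C) => x Ax.
rewrite derive_comp1 ?derive1E//; first exact: smooth_on_differentiable Ax.
apply: diff_derivable; exact: (@smooth_on_differentiable _ _ setT).
Qed.

End SmoothComp.

(** * Flat functions, soft thresholds and steps on the line *)

Section FlatFunctions.
Variable R : realType.
Implicit Types (x y t : R) (p : {poly R}).

(* This family is closed under derivation, so that all its members are smooth. *)
Definition flat p x : R := if 0 < x then p.[x^-1] * expR (- x^-1) else 0.

(** Each monomial satisfies t^i <= i! e^t, by the exponential series. *)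
Lemma horner_expRN_bounded p :
  exists2 C : R, 0 <= C & forall t, 0 <= t -> `|p.[t] * expR (- t)| <= C.
Proof.
exists (\sum_(i < size p) `|p`_i| * (i`!)%:R); first by rewrite sumr_ge0// => i _; rewrite mulr_ge0.
move=> t t0; rewrite horner_coef normrM (ger0_norm (expR_ge0 _)) expRN ler_pdivrMr ?expR_gt0//.
rewrite (le_trans (ler_norm_sum _ _ _))// mulr_suml ler_sum// => i _.
rewrite normrM -mulrA ler_wpM2l// ger0_norm ?exprn_ge0//.
case: (nat_of_ord i) => [|n].
  by rewrite expr0 fact0 mul1r (le_trans _ (expR_ge1Dx t))// lerDl.
rewrite mulrC -ler_pdivrMr ?ltr0n ?fact_gt0//.
by rewrite (le_trans _ (expR_ge1Dxn n t0))// lerDr.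
Qed.

(** For x > 0, deriving in 1/x brings out the factor 1/x^2, hence ['X^2]; the polynomial contributes
    -p' and the exponential p. *)
Lemma is_derive_flat p x : is_derive x 1 (flat p) (flat ('X^2 * (p - p^`())) x).
Proof.
have [x0|x0|->] := ltgtP x 0.
- rewrite {2}/flat ltNge (ltW x0)/=.
  apply: (@near_eq_is_derive _ _ _ (cst 0)).
    near=> y; rewrite /flat ltNge (_ : y <= 0)//=.
    by apply: ltW; near: y; exact: lt_nbhsl.
- apply: (@near_eq_is_derive _ _ _ ((horner p \o GRing.inv) * (expR \o (- GRing.inv)))).
    near=> y; rewrite /flat (_ : 0 < y)//.
    by near: y; exact: lt_nbhsr.
  have xn0 : x != 0 by rewrite gt_eqF.
  have dV : is_derive x 1 (GRing.inv : R -> R) (- x ^- 2).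
    apply: DeriveDef; first exact: (@derivableV _ _ id).
    by rewrite (@deriveV _ _ id)// derive_id -[LHS]/(_ * _) mulr1.
  apply: is_derive_eq.
  rewrite /flat x0 !hornerE -[p.[_] *: _]/(_ * _) -[expR _ *: _]/(_ * _).
  rewrite (_ : (- GRing.inv) x = - x^-1)//=. field.
  by [].
- rewrite {2}/flat ltxx.
  (* For h > 0 the difference quotient at 0 is h times the value at 1/h of X^2 p times the
     exponential, which is bounded; hence the limit 0. *)
  have [C C0 HC] := horner_expRN_bounded ('X^2 * p).
  have lim0 : (fun h => h^-1 *: (flat p (h *: 1 + 0) - flat p 0)) @ 0^' --> (0 : R).
    apply/cvgr0Pnorm_le => e e0; near=> h.
    have hn0 : h != 0 by near: h; exact: nbhs_dnbhs_neq.
    have he : `|h| <= e / (C + 1).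
      near: h; apply: dnbhs0_le; rewrite divr_gt0//; lra.
    rewrite addr0 -[h *: 1]/(h * 1) mulr1 -[_ *: _]/(_ * _) [flat p 0]/flat ltxx subr0 /flat.
    case: ifPn => [h0|_]; last by rewrite mulr0 normr0 ltW.
    rewrite (_ : _ * _ = h * (('X^2 * p).[h^-1] * expR (- h^-1))); last first.
      by rewrite hornerM hornerXn; field.
    rewrite normrM (le_trans (ler_pM _ _ he (HC _ _)))// ?invr_ge0 ?(ltW h0)//.
    rewrite mulrAC ler_pdivrMr; [nra|lra].
  by apply: DeriveDef; [apply/cvg_ex; exists 0|exact: cvg_lim].
Unshelve. all: by end_near. Qed.

Lemma smooth_flat p : smooth_on [set: R] (flat p).
Proof.
move=> k; elim: k p => [|k IH] p.
  by move=> x _; apply/differentiable_continuous/derivable1_diffP; case: (is_derive_flat p x).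
have dp q x : differentiable (flat q) x by apply/derivable1_diffP; case: (is_derive_flat q x).
split=> [x _|v]; first exact: dp.
have C := Ck_on_mul openT (smooth_on_cst setT (v : R) k) (IH ('X^2 * (p - p^`()))).
apply: (Ck_on_eq openT _ C) => x _.
by rewrite deriveE// diff1E// derive1E (@derive_val _ _ _ _ _ _ _ (is_derive_flat p x)).
Qed.

End FlatFunctions.

Section Profiles.
Variable R : realType.
Implicit Types (x y d : R).

Lemma smooth_affine a b : smooth_on [set: R] (fun x => a * x + b).
Proof.
by apply: smooth_on_add; [exact: openT|apply: smooth_on_mul;
  [exact: openT|exact: smooth_on_cst|exact: (smooth_on_id openT)]|exact: smooth_on_cst].
Qed.

Lemma smooth_derivable (u : R -> R) x : smooth_on [set: R] u -> derivable u x 1.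
Proof. by move=> su; apply/derivable1_diffP/(smooth_on_differentiable su). Qed.

Lemma flat_le0 (p : {poly R}) x : x <= 0 -> flat p x = 0.
Proof. by rewrite /flat leNgt => /negbTE ->. Qed.

Lemma flat1E x : 0 < x -> flat 1 x = expR (- x^-1).
Proof. by move=> x0; rewrite /flat x0 hornerC mul1r. Qed.

Lemma flat1_ge0 x : 0 <= flat 1 x.
Proof. by rewrite /flat; case: ifP => // _; rewrite hornerC mul1r expR_ge0. Qed.

Lemma flat1_homo x y : x <= y -> flat 1 x <= flat 1 y.
Proof.
have [x0 _|x0 xy] := leP x 0; first by rewrite flat_le0// flat1_ge0.
have y0 := lt_le_trans x0 xy.
by rewrite !flat1E// ler_expR lerN2 lef_pV2.
Qed.

Lemma derive1_flat1 x : (flat 1)^`()%classic x = flat 'X^2 x.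
Proof.
rewrite derive1E (@derive_val _ _ _ _ _ _ _ (is_derive_flat 1 x)).
by rewrite -polyC1 derivC subr0 mulr1.
Qed.

Lemma flat_bounded (p : {poly R}) : exists2 C : R, 0 <= C & forall x, `|flat p x| <= C.
Proof.
have [C C0 H] := horner_expRN_bounded p; exists C => // x.
by rewrite /flat; case: ifPn => [x0|_]; [rewrite H// invr_ge0 ltW|rewrite normr0].
Qed.

(* This is y e^(-d/y) for y > 0; its slope is at most 1 because (1 + t) e^(-t) <= 1. *)
Definition soft d y : R := y * flat 1 (d^-1 * y + 0).

Lemma smooth_soft d : smooth_on [set: R] (soft d).
Proof.
apply: smooth_on_mul; [exact: openT|exact: (smooth_on_id openT)|].
exact: (smooth_on_comp openT (smooth_flat 1) (smooth_affine _ _)).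
Qed.

Lemma soft_le0 d y : 0 < d -> y <= 0 -> soft d y = 0.
Proof. by move=> d0 y0; rewrite /soft flat_le0 ?mulr0// addr0 pmulr_rle0 ?invr_gt0. Qed.

Lemma softE d y : 0 < d -> 0 < y -> soft d y = y * expR (- (d / y)).
Proof. by move=> d0 y0; rewrite /soft addr0 flat1E ?mulr_gt0 ?invr_gt0// invfM invrK. Qed.

Lemma soft_le d y : 0 < d -> 0 <= y -> soft d y <= y.
Proof.
rewrite le_eqVlt => d0 /predU1P[<-|y0]; first by rewrite soft_le0.
by rewrite softE// ler_piMr ?(ltW y0)// -expR0 ler_expR oppr_le0 divr_ge0 ?ltW.
Qed.

(** This is e^(-t) >= 1 - t at t = d/y: softening costs at most d. *)
Lemma soft_ge d y : 0 < d -> y - d <= soft d y.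
Proof.
move=> d0; have [y0|y0] := leP y 0; first by rewrite soft_le0//; lra.
rewrite softE//; apply: le_trans (ler_wpM2l (ltW y0) (expR_ge1Dx _)).
by rewrite mulrDr mulr1 mulrN mulrCA divff ?gt_eqF// mulr1.
Qed.

Lemma derive1_soft d y : 0 < d ->
  (soft d)^`()%classic y = flat 1 (y / d) + y / d * flat 'X^2 (y / d).
Proof.
move=> d0; have df z : is_derive z (1 : R) (flat (1 : {poly R})) (flat 'X^2 z).
  apply: DeriveDef; [apply: smooth_derivable; exact: smooth_flat|].
  by rewrite -derive1E derive1_flat1.
have da : is_derive y (1 : R) (fun y => d^-1 * y + 0) d^-1.
  by apply: is_derive_eq; rewrite /GRing.scale/=; ring.
rewrite derive1E; apply: derive_val; rewrite /soft.
apply: is_derive_eq; rewrite /GRing.scale/= addr0 mulr1 [d^-1 * y]mulrC; ring.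
Qed.

Lemma derive1_soft_le0 d y : 0 < d -> y <= 0 -> (soft d)^`()%classic y = 0.
Proof.
move=> d0 y0; have yd : y / d <= 0 by rewrite pmulr_lle0 ?invr_gt0.
by rewrite derive1_soft// !flat_le0// mulr0 addr0.
Qed.

Lemma derive1_soft_itv d y : 0 < d -> 0 <= (soft d)^`()%classic y <= 1.
Proof.
move=> d0; have [y0|y0] := leP y 0; first by rewrite derive1_soft_le0// lexx ler01.
have yd : 0 < y / d by rewrite divr_gt0.
rewrite derive1_soft// flat1E// /flat yd hornerXn.
set z := y / d in yd *; have ze : z * (z^-1 ^+ 2 * expR (- z^-1)) = z^-1 * expR (- z^-1).
  by field; rewrite gt_eqF.
rewrite ze -{1 3}[expR _]mul1r -mulrDl mulr_ge0 ?expR_ge0 ?addr_ge0 ?invr_ge0 ?(ltW yd)//=.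
by rewrite expRN ler_pdivrMr ?expR_gt0// mul1r expR_ge1Dx.
Qed.

(* Composing [flat 1] with itself spares the usual quotient of bump functions. *)
Definition step x : R :=
  - (flat 1 (flat 1 1))^-1 * flat 1 (-1 * flat 1 x + flat 1 1) + 1.

Lemma smooth_step : smooth_on [set: R] step.
Proof.
have s1 := smooth_on_comp openT (smooth_affine (-1) (flat 1 1)) (smooth_flat (1 : {poly R})).
have s2 := smooth_on_comp openT (smooth_flat 1) s1.
exact: (smooth_on_comp openT (smooth_affine (- (flat 1 (flat 1 1))^-1) 1) s2).
Qed.

Let flat11_gt0 : 0 < flat 1 (flat 1 (1 : R)).
Proof. by rewrite [flat 1 1]flat1E// flat1E ?expR_gt0. Qed.

(** In this form the two plateaus are visible: for x <= 0 the inner difference is [flat 1 1] and the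
    quotient is 1; for x >= 1 the difference is nonpositive and the quotient is 0. *)
Let stepE x : step x = 1 - flat 1 (flat 1 1 - flat 1 x) / flat 1 (flat 1 1).
Proof.
rewrite /step (_ : -1 * _ + _ = flat 1 1 - flat 1 x); last by ring.
by rewrite mulNr addrC mulrC.
Qed.

Lemma step_le0 x : x <= 0 -> step x = 0.
Proof. by move=> x0; rewrite stepE [flat 1 x]flat_le0// subr0 divff ?subrr// gt_eqF. Qed.

Lemma step_ge1 x : 1 <= x -> step x = 1.
Proof.
by move=> x1; rewrite stepE flat_le0 ?mul0r ?subr0// subr_le0 flat1_homo.
Qed.

Lemma step_itv x : 0 <= step x <= 1.
Proof.
rewrite stepE subr_ge0 gerBl ler_pdivrMr// mul1r flat1_homo ?lerBlDr ?lerDl ?flat1_ge0//=.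
by rewrite divr_ge0 ?flat1_ge0 ?ltW.
Qed.

(** Both chain rule factors are values of [flat 'X^2], which is bounded on the whole line. This
    bounds the growth of brackets when p = 0. *)
Lemma derive1_step_bounded : exists C : R, forall x, `|step^`()%classic x| <= C.
Proof.
have [C C0 HC] := flat_bounded 'X^2.
exists ((flat 1 (flat 1 1))^-1 * (C * C)) => x.
have df z : is_derive z (1 : R) (flat (1 : {poly R})) (flat 'X^2 z).
  apply: DeriveDef; [apply: smooth_derivable; exact: smooth_flat|].
  by rewrite -derive1E derive1_flat1.
set z := -1 * flat 1 x + flat 1 1.
rewrite (_ : step^`()%classic x = (flat 1 (flat 1 1))^-1 * (flat 'X^2 z * flat 'X^2 x)).
  have f0 : 0 <= (flat 1 (flat 1 (1 : R)))^-1 by rewrite invr_ge0 ltW.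
  by rewrite normrM (ger0_norm f0) ler_wpM2l// normrM ler_pM.
rewrite derive1E; apply: derive_val; rewrite /step.
have dz : is_derive x (1 : R) (fun x => -1 * flat 1 x + flat 1 1) (- flat 'X^2 x).
  by apply: is_derive_eq; rewrite /GRing.scale/=; ring.
apply: is_derive_eq; rewrite /GRing.scale/= -/z; ring.
Qed.

End Profiles.

(** * Compactly supported functions on a manifold *)

(** Finite subcovers in filter form: for each [W] with [P W], take the sets [V] with [P V] that
    contain [W]. These families generate a filter because [P] is stable under unions, and near each
    point of K this filter eventually covers. *)
Lemma compact_gluing (T : topologicalType) (K : set T) (P : set T -> Prop) :
  compact K -> P set0 -> (forall A B, P A -> P B -> P (A `|` B)) ->
  (forall x, K x -> exists U : set T, [/\ open U, U x & P U]) ->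
  exists2 V, K `<=` V & P V.
Proof.
move=> /compact_near_coveringP cK P0 PU HU.
pose G := filter_from P (fun W => [set V : set T | P V /\ W `<=` V]).
have FG : Filter G.
  apply: filter_from_filter; first by exists set0.
  move=> A B PA PB; exists (A `|` B); first exact: PU.
  by move=> V [PV ABV]; split; split=> // y ?; apply: ABV; [left|right].
have [|W PW KW] := cK _ G (fun V x => V x) FG; last by exists W => //; apply: (KW W); split.
move=> x /HU[U [oU Ux PUU]]; exists (U, [set V | P V /\ U `<=` V]).
  by split; [apply: open_nbhs_nbhs|exists U].
by move=> [y V] /= [Uy [_ UV]]; exact: UV.
Qed.

(** * The uniform norm *)

Section UniformNorm.
Variables (R : realType) (M : topologicalType).
Implicit Types f g : M -> R.

Definition bounded f := exists B : R, forall p, `|f p| <= B.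

(** Valid for every [f], since [sup] is 0 on an empty or unbounded range. *)
Lemma unorm_ge0 f : 0 <= unorm f.
Proof.
rewrite /unorm; have [->|/set0P[_ [p _ _]]] := eqVneq (range (fun p => `|f p|)) set0.
  by rewrite sup0.
have [[B HB]|nB] := pselect (bounded f).
  apply: le_trans (normr_ge0 (f p)) _; apply: ub_le_sup; last by exists p.
  by exists B => _ [q _ <-].
rewrite sup_out// => -[_ [B HB]]; apply: nB; exists B => q.
by apply: HB; exists q.
Qed.

Lemma le_unorm f p : bounded f -> `|f p| <= unorm f.
Proof. by move=> [B HB]; apply: ub_le_sup; [exists B => _ [q _ <-]|exists p]. Qed.

Lemma unorm_le f (B : R) : 0 <= B -> (forall p, `|f p| <= B) -> unorm f <= B.
Proof.
move=> B0 HB; rewrite /unorm; have [->|/set0P ne] := eqVneq (range (fun p => `|f p|)) set0.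
  by rewrite sup0.
by apply: ge_sup => // _ [p _ <-].
Qed.

Lemma unormN f g : (forall p, f p = - g p) -> unorm f = unorm g.
Proof.
move=> fg; rewrite /unorm (_ : (fun p => `|f p|) = (fun p => `|g p|))//.
by apply/funext => p; rewrite fg normrN.
Qed.

End UniformNorm.

(** * Smooth functions in charts and compact supports *)

Section Functions.
Variables (R : realType) (m : nat) (M : topologicalType) (S : smooth_manifold R m M).
Implicit Types (F G H : M -> R) (c d : chart R m M) (p q : M).

Lemma overlap_open c d : open (overlap c d).
Proof.
(* [cinv c] is total but only known to be continuous on [cimg c], so the preimage of [cdom d] is
   replaced by its interior. *)
have -> : overlap c d = cimg c `&` [set x | nbhs x (cinv c @^-1` cdom d)].
  apply/seteqP; split=> [_ [p [cp dp] <-]|x [[p cp <-]] /nbhs_singleton]; last first.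
    by rewrite /preimage/= cmapK// => dp; exists p.
  have cip : cimg c (cmap c p) by exists p.
  split=> //; apply: (cinv_continuous cip).
  by rewrite cmapK//; apply: open_nbhs_nbhs; split; first exact: cdom_open.
rewrite openE => x [cx dx]; apply: filterI.
  by apply: open_nbhs_nbhs; split => //; exact: cimg_open.
by apply/nbhs_interior; exact: dx.
Qed.

Lemma overlap_cimg c d x : overlap c d x -> cimg c x.
Proof. by move=> [p [cp _] <-]; exists p. Qed.

Lemma transition_overlap c d x : overlap c d x -> overlap d c (transition c d x).
Proof. by move=> [p [cp dp] <-]; exists p => //; rewrite /transition/= cmapK. Qed.

Lemma transitionK c d x : overlap c d x -> transition d c (transition c d x) = x.
Proof. by move=> [p [cp dp] <-]; rewrite /transition/= !cmapK. Qed.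

Lemma cinv_transition c d x : overlap c d x -> cinv d (transition c d x) = cinv c x.
Proof. by move=> [p [cp dp] <-]; rewrite /transition/= !cmapK. Qed.

Lemma near_overlap c d x : overlap c d x -> \near x, overlap c d x.
Proof. by move=> ox; apply: open_nbhs_nbhs; split => //; exact: overlap_open. Qed.

Lemma smooth_fun_comp (u : R -> R) F :
  smooth_on [set: R] u -> smooth_fun S F -> smooth_fun S (fun p => u (F p)).
Proof.
move=> su sF c Sc; exact: (smooth_on_comp (@cimg_open _ _ _ c) su (sF c Sc)).
Qed.

Lemma smooth_fun_cst (a : R) : smooth_fun S (fun=> a).
Proof. by move=> c Sc; exact: smooth_on_cst. Qed.

Lemma smooth_fun_add F G :
  smooth_fun S F -> smooth_fun S G -> smooth_fun S (fun p => F p + G p).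
Proof.
move=> sF sG c Sc.
exact: (smooth_on_add (@cimg_open _ _ _ c) (sF c Sc) (sG c Sc)).
Qed.

Lemma smooth_fun_mul F G :
  smooth_fun S F -> smooth_fun S G -> smooth_fun S (fun p => F p * G p).
Proof.
move=> sF sG c Sc.
exact: (smooth_on_mul (@cimg_open _ _ _ c) (sF c Sc) (sG c Sc)).
Qed.

Lemma smooth_fun_differentiable F c x :
  atlas S c -> smooth_fun S F -> cimg c x -> differentiable (F \o cinv c) x.
Proof. by move=> Sc sF; apply: smooth_on_differentiable; exact: sF. Qed.

Lemma cdom_chart_at p : cimg (chart_at S p) (cmap (chart_at S p) p).
Proof. by exists p => //; exact: chart_at_dom. Qed.

Lemma smooth_fun_continuous F : smooth_fun S F -> continuous F.
Proof.
move=> sF p; set c := chart_at S p.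
have cp : cdom c p by exact: chart_at_dom.
have cF : {for cmap c p, continuous (F \o cinv c)}.
  by apply: smooth_on_continuous (cdom_chart_at p); apply: sF; exact: chart_at_atlas.
have cFc : {for p, continuous (F \o cinv c \o cmap c)}.
  by apply: continuous_comp cF; exact: cmap_continuous.
have E : (F \o cinv c \o cmap c) p = F p by rewrite /= cmapK.
suff : F @ p --> F p by [].
rewrite -E; apply: cvg_trans cFc; apply: near_eq_cvg.
apply: filterS (open_nbhs_nbhs (conj (cdom_open c) cp)) => q cq.
by rewrite /= cmapK.
Qed.

Lemma compactly_supported_sub F G H :
  (forall p, F p = 0 -> G p = 0 -> H p = 0) ->
  compactly_supported F -> compactly_supported G -> compactly_supported H.
Proof.
move=> FGH cF cG; apply: (subclosed_compact _ (compactU cF cG)); first exact: closed_closure.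
rewrite -closureU; apply: closureS => p; apply: contra_neqP => /not_orP[].
by move=> /negP; rewrite negbK => /eqP Fp /negP; rewrite negbK => /eqP; exact: FGH.
Qed.

Lemma continuous_bounded F : continuous F -> compactly_supported F -> bounded F.
Proof.
move=> sF cF.
have [V KV [B HB]] : exists2 V, closure [set p | F p != 0] `<=` V &
    exists B : R, forall p, V p -> `|F p| <= B.
  apply: (compact_gluing cF); first by exists 0.
    move=> A1 A2 [B1 H1] [B2 H2]; exists (Num.max B1 B2) => p [/H1|/H2];
    by rewrite le_max => ->; rewrite ?orbT.
  move=> p _.
  have /nbhs_interior : nbhs p [set q | `|F q| < `|F p| + 1].
    have Fp : (fun q => `|F q|) @ p --> `|F p| by apply: cvg_norm; exact: sF.
    by apply: (cvgr_lt _ Fp); rewrite ltrDl.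
  move=> np; exists (interior [set q | `|F q| < `|F p| + 1]); split.
  - exact: open_interior.
  - exact: nbhs_singleton.
  - by exists (`|F p| + 1) => q /interior_subset /ltW.
exists (Num.max 0 B) => p; rewrite le_max.
have [->|Fp] := eqVneq (F p) 0; first by rewrite normr0 lexx.
by rewrite HB ?orbT//; apply/KV/subset_closure.
Qed.

Lemma Cc_infty_bounded F : Cc_infty S F -> bounded F.
Proof. by move=> [sF cF]; apply: continuous_bounded => //; exact: smooth_fun_continuous. Qed.

Lemma Cc_infty_op (h : R -> R -> R) F G :
  h 0 0 = 0 -> smooth_fun S (fun p => h (F p) (G p)) ->
  Cc_infty S F -> Cc_infty S G -> Cc_infty S (fun p => h (F p) (G p)).
Proof.
move=> h0 sh [_ cF] [_ cG]; split => //.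
by apply: compactly_supported_sub cF cG => p -> ->.
Qed.

Lemma Cc_infty_add F G :
  Cc_infty S F -> Cc_infty S G -> Cc_infty S (fun p => F p + G p).
Proof.
move=> cF cG; apply: Cc_infty_op => //; first by rewrite addr0.
by apply: smooth_fun_add; [case: cF|case: cG].
Qed.

Lemma Cc_infty_comp (u : R -> R) F :
  smooth_on [set: R] u -> u 0 = 0 -> Cc_infty S F -> Cc_infty S (fun p => u (F p)).
Proof.
move=> su u0 cF; apply: (@Cc_infty_op (fun x _ => u x) _ _ u0 _ cF cF).
by apply: smooth_fun_comp => //; case: cF.
Qed.

Lemma Cc_infty_scale (a : R) F : Cc_infty S F -> Cc_infty S (fun p => a * F p).
Proof.
move=> cF; have := Cc_infty_comp (smooth_affine a 0) _ cF.
rewrite mulr0 addr0 => /(_ erefl); congr (Cc_infty S _).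
by apply/funext => p; rewrite addr0.
Qed.

Lemma Cc_infty0 : Cc_infty S (fun=> 0).
Proof.
split; first exact: smooth_fun_cst.
rewrite /compactly_supported (_ : [set _ | _] = set0) ?closure0; first exact: compact0.
by apply/seteqP; split => // p; rewrite /= eqxx.
Qed.

Lemma Cc_infty_sub F G : Cc_infty S F -> Cc_infty S G -> Cc_infty S (F \- G).
Proof.
move=> cF cG; have := Cc_infty_add cF (Cc_infty_scale (-1) cG).
by congr (Cc_infty S _); apply/funext => p; rewrite mulN1r.
Qed.

End Functions.

(** * The Poisson bracket *)

Section Determinant.
Variables (R : realType) (U : normedModType R) (A : set U).
Hypothesis oA : open A.

Lemma smooth_on_det n (B : U -> 'M[R]_n) :
  (forall i j, smooth_on A (fun x => B x i j)) -> smooth_on A (fun x => \det (B x)).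
Proof.
move=> sB; apply: smooth_on_sum => // s _; apply: smooth_on_mul => //; first exact: smooth_on_cst.
by apply: smooth_on_prod.
Qed.

Lemma smooth_on_adj n (B : U -> 'M[R]_n) i j :
  (forall i j, smooth_on A (fun x => B x i j)) -> smooth_on A (fun x => (\adj (B x)) i j).
Proof.
move=> sB.
apply: (smooth_on_eq oA (f := fun x => (-1) ^+ (j + i) * \det (row' j (col' i (B x))))).
  by move=> x _; rewrite mxE.
apply: smooth_on_mul => //; first exact: smooth_on_cst.
apply: smooth_on_det => k l; apply: smooth_on_eq (sB (lift j k) (lift i l)) => // x _.
by rewrite !mxE.
Qed.

End Determinant.

Section Bilin.
Variables (R : realType) (m : nat) (A : 'M[R]_m).
Implicit Types u v z : 'rV[R]_m.

Lemma bilinDl a b u v z : bilin A (a *: u + b *: v) z = a * bilin A u z + b * bilin A v z.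
Proof. by rewrite /bilin !mulmxDl -!scalemxAl !mxE. Qed.

Lemma bilinDr a b u v z : bilin A z (a *: u + b *: v) = a * bilin A z u + b * bilin A z v.
Proof. by rewrite /bilin linearD !linearZ/= mulmxDr -!scalemxAr !mxE. Qed.

Lemma nondegenerate_unitmx :
  (forall v, (forall u, bilin A v u = 0) -> v = 0) -> A \in unitmx.
Proof.
move=> nd; rewrite -row_free_unit -kermx_eq0; apply/rowV0P => v /sub_kermxP vA.
by apply: nd => u; rewrite /bilin vA mul0mx mxE.
Qed.

End Bilin.

Section Poisson.
Variables (R : realType) (m : nat) (M : topologicalType) (S : smooth_manifold R m M).
Variable w : symplectic_form S.
Implicit Types (F G H : M -> R) (c d : chart R m M) (p q : M) (x u v : 'rV[R]_m).

Lemma omegaN c x u v : atlas S c -> cimg c x ->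
  bilin (omega w c x) u v = - bilin (omega w c x) v u.
Proof.
move=> Sc cx; have := omega_alternating w Sc cx (1 *: u + 1 *: v).
rewrite bilinDl !bilinDr !omega_alternating// !mul1r add0r addr0.
by move/eqP; rewrite addr_eq0 => /eqP.
Qed.

Definition grad c F x : 'rV[R]_m := \row_j 'D_('e_j) (F \o cinv c) x.

Lemma derive_grad c F x u : differentiable (F \o cinv c) x ->
  'D_u (F \o cinv c) x = (grad c F x *m u^T) 0 0.
Proof.
move=> dF; rewrite deriveE// {1}(row_sum_delta u) linear_sum !mxE.
by apply: eq_bigr => j _; rewrite linearZ !mxE deriveE// mulrC.
Qed.

(** Shows that the choice made by [get] is meaningful: invertibility of the matrix gives a solution,
    nondegeneracy makes it the only one. *)
Lemma sgradE c F x : atlas S c -> smooth_fun S F -> cimg c x ->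
  sgrad w c F x = - (grad c F x *m invmx (omega w c x)).
Proof.
move=> Sc sF cx; have dF := smooth_fun_differentiable Sc sF cx.
have nd := omega_nondegenerate (s:=w) Sc cx.
have uA := nondegenerate_unitmx nd.
have Ev u : bilin (omega w c x) (- (grad c F x *m invmx (omega w c x))) u =
    - 'D_u (F \o cinv c) x.
  by rewrite derive_grad// /bilin !mulNmx mulmxKV// mxE.
have := @getI _ [set v | forall u, bilin (omega w c x) v u = - 'D_u (F \o cinv c) x] _ Ev.
rewrite -/(sgrad w c F x) /= => Es.
apply/eqP; rewrite -subr_eq0; apply/eqP/nd => u.
have := bilinDl (omega w c x) 1 (-1) (sgrad w c F x) (- (grad c F x *m invmx (omega w c x))) u.
by rewrite scale1r scaleN1r Es Ev => ->; ring.
Qed.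

Lemma sgradP c F x u : atlas S c -> smooth_fun S F -> cimg c x ->
  bilin (omega w c x) (sgrad w c F x) u = - 'D_u (F \o cinv c) x.
Proof.
move=> Sc sF cx; rewrite sgradE// derive_grad; last exact: smooth_fun_differentiable Sc sF cx.
have uA := nondegenerate_unitmx (omega_nondegenerate (s:=w) Sc cx).
by rewrite /bilin !mulNmx mulmxKV// mxE.
Qed.

Lemma sgrad_unique c F x v : atlas S c -> smooth_fun S F -> cimg c x ->
  (forall u, bilin (omega w c x) v u = - 'D_u (F \o cinv c) x) -> v = sgrad w c F x.
Proof.
move=> Sc sF cx Ev.
apply/eqP; rewrite -subr_eq0; apply/eqP/(omega_nondegenerate (s:=w) Sc cx) => u.
have := bilinDl (omega w c x) 1 (-1) v (sgrad w c F x) u.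
by rewrite scale1r scaleN1r sgradP// Ev => ->; ring.
Qed.

Lemma derive_transition c d F x u : atlas S c -> atlas S d -> smooth_fun S F ->
  overlap c d x ->
  'D_u (F \o cinv c) x = 'D_('D_u (transition c d) x) (F \o cinv d) (transition c d x).
Proof.
move=> Sc Sd sF ox.
have dT := smooth_on_differentiable (transition_smooth Sc Sd) ox.
have dF := smooth_fun_differentiable Sd sF (overlap_cimg (transition_overlap ox)).
rewrite (@near_eq_derive _ _ _ _ ((F \o cinv d) \o transition c d)); last first.
  by apply: filterS (near_overlap ox) => y oy; rewrite /= cinv_transition.
by rewrite [LHS]deriveE ?diff_comp//=; [rewrite -!deriveE|exact: differentiable_comp].
Qed.

(** So every test vector in the chart [d] is the image of one in the chart [c], as needed to
    characterise a gradient in [d] by pulling back to [c]. *)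
Lemma derive_transitionK c d x u : atlas S c -> atlas S d -> overlap c d x ->
  'D_('D_u (transition d c) (transition c d x)) (transition c d) x = u.
Proof.
move=> Sc Sd ox; set y := transition c d x.
have oy : overlap d c y := transition_overlap ox.
have yx : transition d c y = x by rewrite /y transitionK.
have dT := smooth_on_differentiable (transition_smooth Sc Sd) ox.
have dT' := smooth_on_differentiable (transition_smooth Sd Sc) oy.
have : 'D_u (transition c d \o transition d c) y = u.
  rewrite -[RHS](derive_id y u); apply: near_eq_derive.
  by apply: filterS (near_overlap oy) => z oz; rewrite /= transitionK.
rewrite deriveE; last by apply: differentiable_comp; rewrite ?yx.
by rewrite diff_comp ?yx//= -!deriveE.
Qed.

(** Hamiltonian vectors are geometric: the pushed vector satisfies the defining equation in [d], by
    the pullback rule for the form and the chain rule for [F], and the solution is unique. *)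
Lemma sgrad_transition c d F x : atlas S c -> atlas S d -> smooth_fun S F ->
  overlap c d x ->
  'D_(sgrad w c F x) (transition c d) x = sgrad w d F (transition c d x).
Proof.
move=> Sc Sd sF ox; apply: sgrad_unique => //.
  exact: overlap_cimg (transition_overlap ox).
move=> u; rewrite -(derive_transitionK u Sc Sd ox) -derive_transition//.
by rewrite -omega_pullback// sgradP//; exact: overlap_cimg ox.
Qed.

(** The definition uses [chart_at S p], which may jump with [p]; local arguments need one chart for
    all nearby points. *)
Lemma poisson_chart c F G p : atlas S c -> smooth_fun S F -> smooth_fun S G -> cdom c p ->
  poisson w F G p =
  bilin (omega w c (cmap c p)) (sgrad w c G (cmap c p)) (sgrad w c F (cmap c p)).
Proof.
move=> Sc sF sG cp; rewrite /poisson/=; set b := chart_at S p.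
have Sb : atlas S b by exact: chart_at_atlas.
have ob : overlap b c (cmap b p) by exists p => //; split => //; exact: chart_at_dom.
have <- : transition b c (cmap b p) = cmap c p.
  by rewrite /transition/= cmapK//; exact: chart_at_dom.
by rewrite -!sgrad_transition// -omega_pullback.
Qed.

Lemma continuous_poisson F G : smooth_fun S F -> smooth_fun S G -> continuous (poisson w F G).
Proof.
move=> sF sG p; set c := chart_at S p.
have Sc : atlas S c by exact: chart_at_atlas.
have cp : cdom c p by exact: chart_at_dom.
have oc : open (cimg c) by exact: cimg_open.
have sO i j := smooth_on_coord oc i j (omega_smooth w Sc).
have sgr H j : smooth_fun S H -> smooth_on (cimg c) (fun x => grad c H x 0 j).
  move=> sH; apply: smooth_on_eq (smooth_onD 'e_j (sH c Sc)) => // x _.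
  by rewrite mxE.
(* By Cramer's rule the bracket is N / det, with N and det polynomial in the first derivatives of F,
   G and the entries of the form. *)
pose N x := (grad c F x *m \adj (omega w c x) *m (grad c G x)^T) 0 0.
have sN : smooth_on (cimg c) N.
  apply: (smooth_on_eq oc (f := fun x => \sum_j (\sum_i grad c F x 0 i *
      (\adj (omega w c x)) i j) * grad c G x 0 j)).
    move=> x _; rewrite /N mxE; apply: eq_bigr => j _.
    by rewrite !mxE; congr (_ * _); apply: eq_bigr.
  apply: smooth_on_sum => // j _; apply: smooth_on_mul => //; last exact: sgr.
  apply: smooth_on_sum => // i _; apply: smooth_on_mul => //; first exact: sgr.
  exact: smooth_on_adj.
have sD := smooth_on_det oc sO.
have PE q : cdom c q -> (\det (omega w c (cmap c q)))^-1 * N (cmap c q) = poisson w F G q.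
  move=> cq; have cx : cimg c (cmap c q) by exists q.
  have uA := nondegenerate_unitmx (omega_nondegenerate (s:=w) Sc cx).
  rewrite (poisson_chart Sc)// sgradP// derive_grad; last exact: smooth_fun_differentiable Sc sG cx.
  rewrite sgradE// /invmx uA /N -scalemxAr.
  have T (a b : 'rV[R]_m) : (a *m b^T) 0 0 = (b *m a^T) 0 0.
    by rewrite -[in LHS](trmxK a) -trmx_mul mxE.
  by rewrite [in RHS]T mulNmx -scalemxAl !mxE opprK.
have cx : cimg c (cmap c p) by exists p.
have uA := nondegenerate_unitmx (omega_nondegenerate (s:=w) Sc cx).
suff : poisson w F G @ p --> poisson w F G p by [].
rewrite -(PE p cp).
have lim : (fun q => (\det (omega w c (cmap c q)))^-1 * N (cmap c q)) @ p -->
    (\det (omega w c (cmap c p)))^-1 * N (cmap c p).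
  have cc := cmap_continuous cp.
  apply: cvgM.
    apply: cvgV; first by move: uA; rewrite unitmxE unitfE.
    exact: (@continuous_comp _ _ _ (cmap c) _ p cc (smooth_on_continuous sD cx)).
  exact: (@continuous_comp _ _ _ (cmap c) _ p cc (smooth_on_continuous sN cx)).
apply: cvg_trans lim; apply: near_eq_cvg.
by apply: filterS (open_nbhs_nbhs (conj (cdom_open c) cp)) => q /PE.
Qed.

Lemma poisson_eq0 F G p : smooth_fun S F -> smooth_fun S G ->
  (\near p, F p = 0) -> poisson w F G p = 0.
Proof.
move=> sF sG F0; have Sc := chart_at_atlas S p; set c := chart_at S p in Sc.
have cp : cdom c p by exact: chart_at_dom.
have cx : cimg c (cmap c p) by exists p.
rewrite (poisson_chart Sc)// omegaN// sgradP// opprK.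
rewrite -[RHS](derive_cst (0 : R) (cmap c p) (sgrad w c G (cmap c p))).
apply: near_eq_derive.
have cF := cinv_continuous cx.
have : nbhs (cinv c (cmap c p)) [set q | F q = 0] by rewrite cmapK.
by move/cF.
Qed.

(** The bracket is continuous, and it vanishes wherever F vanishes nearby, so its support lies in
    that of F. *)
Lemma bounded_poisson F G : Cc_infty S F -> Cc_infty S G -> bounded (poisson w F G).
Proof.
move=> [sF cF] [sG cG]; apply: continuous_bounded; first exact: continuous_poisson.
apply: (subclosed_compact _ cF); first exact: closed_closure.
rewrite [X in _ `<=` X](closure_id _).1; last exact: closed_closure.
apply: closureS => p /= Pp; apply: contrapT => nFp.
have /existsNP[B /not_implyP[Bp nB]] : ~ (forall B, nbhs p B -> [set p | F p != 0] `&` B !=set0).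
  by [].
move/eqP: Pp; apply; apply: poisson_eq0 => //; apply: filterS Bp => q Bq.
by apply: contrapT => /eqP Fq; apply: nB; exists q.
Qed.

Lemma le_unorm_poisson F G p : Cc_infty S F -> Cc_infty S G ->
  `|poisson w F G p| <= unorm (poisson w F G).
Proof. by move=> cF cG; apply/le_unorm/bounded_poisson. Qed.

(* The Jacobian rule: [a, b, a', b'] are the partial derivatives at p of a change of
   functions (F, G) -> (F', G'). *)
Lemma poisson_jacobian F G F' G' p (a b a' b' : R) :
  smooth_fun S F -> smooth_fun S G -> smooth_fun S F' -> smooth_fun S G' ->
  (forall c x u, atlas S c -> cimg c x -> cinv c x = p ->
    'D_u (F' \o cinv c) x = a * 'D_u (F \o cinv c) x + b * 'D_u (G \o cinv c) x) ->
  (forall c x u, atlas S c -> cimg c x -> cinv c x = p ->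
    'D_u (G' \o cinv c) x = a' * 'D_u (F \o cinv c) x + b' * 'D_u (G \o cinv c) x) ->
  poisson w F' G' p = (a * b' - b * a') * poisson w F G p.
Proof.
move=> sF sG sF' sG' HF HG; have Sc := chart_at_atlas S p; set c := chart_at S p in Sc.
have cp : cdom c p by exact: chart_at_dom.
have cx : cimg c (cmap c p) by exists p.
have cxp : cinv c (cmap c p) = p by rewrite cmapK.
have E H' (a1 b1 : R) : smooth_fun S H' ->
    (forall u, 'D_u (H' \o cinv c) (cmap c p) =
      a1 * 'D_u (F \o cinv c) (cmap c p) + b1 * 'D_u (G \o cinv c) (cmap c p)) ->
    sgrad w c H' (cmap c p) =
      a1 *: sgrad w c F (cmap c p) + b1 *: sgrad w c G (cmap c p).
  move=> sH' HH; apply/esym/sgrad_unique => // u.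
  by rewrite bilinDl !sgradP// HH; ring.
rewrite !(poisson_chart Sc)// (E F' a b)//; last by move=> u; exact: HF.
rewrite (E G' a' b')//; last by move=> u; exact: HG.
rewrite bilinDl !bilinDr !omega_alternating//.
by rewrite [bilin _ (sgrad w c F _) (sgrad w c G _)]omegaN//; ring.
Qed.

End Poisson.

(** * Bump functions *)

Section Bumps.
Variables (R : realType) (m : nat) (M : topologicalType) (S : smooth_manifold R m M).

(** The norm on row vectors is the max norm, which is not smooth; the squared Euclidean distance is
    a polynomial. *)
Definition sqdist (a x : 'rV[R]_m) : R := \sum_i (x 0 i - a 0 i) ^+ 2.

Lemma smooth_sqdist (U : normedModType R) (A : set U) (f : U -> 'rV[R]_m) a :
  open A -> smooth_on A f -> smooth_on A (fun x => sqdist a (f x)).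
Proof.
move=> oA sf; apply: smooth_on_sum => // i _.
have si : smooth_on A (fun x => f x 0 i - a 0 i).
  by apply: smooth_on_add => //; [exact: smooth_on_coord|exact: smooth_on_cst].
by apply: smooth_on_eq (smooth_on_mul oA si si) => // x _; rewrite expr2.
Qed.

Lemma continuous_sqdist a : continuous (sqdist a).
Proof.
move=> x; have sq := smooth_sqdist a openT (smooth_on_id (@openT 'rV[R]_m)).
exact: smooth_on_continuous sq I.
Qed.

Lemma sqdist_ball a x e : 0 < e -> sqdist a x <= (e / 2) ^+ 2 -> ball a e x.
Proof.
move=> e0 axe; split => // i j; rewrite ord1 /ball/= distrC.
have : (x 0 j - a 0 j) ^+ 2 <= (e / 2) ^+ 2.
  apply: le_trans axe; rewrite /sqdist (bigD1 j)//= lerDl sumr_ge0// => k _.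
  exact: sqr_ge0.
by set t := x 0 j - a 0 j => te; rewrite ltr_norml; apply/andP; split; nra.
Qed.

Lemma exists_bump (p : M) (V : set M) : open V -> V p ->
  exists b : M -> R, exists U : set M,
    [/\ Cc_infty S b, (forall q, 0 <= b q), (forall q, ~ V q -> b q = 0), open U /\ U p &
        forall q, U q -> 1 <= b q].
Proof.
move=> oV Vp; have Sc := chart_at_atlas S p; set c := chart_at S p in Sc.
have cp : cdom c p by exact: chart_at_dom.
have cx : cimg c (cmap c p) by exists p.
set a := cmap c p in cx *.
have [e /= e0 ae] : exists2 e : R, 0 < e & ball a e `<=` cimg c `&` cinv c @^-1` V.
  apply/nbhs_ballP; apply: filterI.
    by apply: open_nbhs_nbhs; split => //; exact: cimg_open.
  have ca := cinv_continuous cx.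
  have : nbhs (cinv c a) V by rewrite cmapK//; apply: open_nbhs_nbhs.
  by move/ca.
pose s := (e / 2) ^+ 2; have s0 : 0 < s by rewrite exprn_gt0// divr_gt0.
pose D := [set x | sqdist a x <= s].
have Dball : D `<=` ball a e by move=> x; exact: sqdist_ball.
have cD : compact D.
  apply: bounded_closed_compact.
    exists (`|a| + e); split=> [|B aB x /Dball]; first exact: num_real.
    rewrite -ball_normE/= distrC => ax; apply: le_trans (ltW aB).
    by rewrite -[x](subrKC a) (le_trans (ler_normD _ _))// lerD2l ltW.
  have -> : D = sqdist a @^-1` [set y | y <= s] by [].
  by apply: preimage_closed (@closed_le _ s) => // x _; exact: continuous_sqdist.
pose Q := cinv c @` D.
have cQ : compact Q.
  apply: continuous_compact => //; apply: continuous_in_subspaceT => x.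
  by rewrite inE => /Dball/ae[cix _]; exact: cinv_continuous.
(* The Hausdorff property makes the complement of Q open, so the extension by 0 is smooth at the
   points outside the chart domain. *)
have clQ : closed Q := compact_closed (hausdorffM S) cQ.
have QV q : Q q -> cdom c q /\ V q.
  move=> [x /Dball/ae[[r cr <-] /= Vx] <-]; split => //.
  by rewrite cmapK.
have K0 : 0 < (flat 1 (s / 2))^-1 by rewrite invr_gt0 flat1E ?expR_gt0 ?divr_gt0.
(* The normalising factor makes the value at least 1 where the squared distance is below s/2. *)
pose beta x := (flat 1 (s / 2))^-1 * flat 1 (-1 * sqdist a x + s).
have beta0 x : ~ D x -> beta x = 0.
  move=> /negP; rewrite -ltNge => xs; rewrite /beta [X in _ * X]flat_le0 ?mulr0// mulN1r.
  by rewrite addrC subr_le0 ltW.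
have beta_ge0 x : 0 <= beta x by rewrite mulr_ge0 ?flat1_ge0 ?ltW.
pose b q := if `[< cdom c q >] then beta (cmap c q) else 0.
have b0 q : ~ Q q -> b q = 0.
  move=> nQ; rewrite /b; case: asboolP => // cq; apply: beta0 => Dq; apply: nQ.
  by exists (cmap c q) => //; rewrite cmapK.
exists b, (interior (cdom c `&` [set q | sqdist a (cmap c q) < s / 2])); split.
- split.
    move=> d Sd; apply: smooth_on_local => y dy.
    have [cq|ncq] := pselect (cdom c (cinv d y)).
      have oy : overlap d c y.
        by move: dy cq => [q dq <-]; rewrite cmapK// => cq; exists q.
      exists (overlap d c); split => //; first exact: overlap_open.
      have sT := smooth_sqdist a (@overlap_open _ _ _ d c) (transition_smooth Sd Sc).
      have sb := smooth_on_comp (@overlap_open _ _ _ d c) (smooth_affine (-1) s) sT.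
      have {}sb := smooth_on_comp (@overlap_open _ _ _ d c) (smooth_flat 1) sb.
      have {}sb := smooth_on_comp (@overlap_open _ _ _ d c)
        (smooth_affine (flat 1 (s / 2))^-1 0) sb.
      apply: (smooth_on_eq (@overlap_open _ _ _ d c) _ sb) => _ [q [dq cq'] <-].
      by rewrite /b /= cmapK//; case: asboolP => // _; rewrite addr0 /transition/= cmapK.
    exists (interior (cimg d `&` cinv d @^-1` (~` Q))); split.
    + exact: open_interior.
    + apply: nbhs_singleton; apply/nbhs_interior; apply: filterI.
        by apply: open_nbhs_nbhs; split => //; exact: cimg_open.
      have cd := cinv_continuous dy.
      have : nbhs (cinv d y) (~` Q).
        by apply: open_nbhs_nbhs; split; [exact: closed_openC|move/QV => -[]].
      by move/cd.
    + apply: (smooth_on_eq (@open_interior _ _) _ (smooth_on_cst _ (0 : R))) => x.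
      by move=> /interior_subset[_ /= /b0].
  apply: (subclosed_compact _ cQ); first exact: closed_closure.
  rewrite [X in _ `<=` X](closure_id _).1//; apply: closureS => q /= bq.
  by apply: contrapT => /b0 /eqP; rewrite (negbTE bq).
- by move=> q; rewrite /b; case: ifP.
- by move=> q nV; apply: b0 => /QV[].
- split; first exact: open_interior.
  apply: nbhs_singleton; apply/nbhs_interior; apply: filterI.
    by apply: open_nbhs_nbhs; split => //; exact: cdom_open.
  have ca := cmap_continuous cp.
  have : nbhs a [set x | sqdist a x < s / 2].
    apply: (cvgr_lt _ (@continuous_sqdist a a)).
    by rewrite /sqdist big1 ?divr_gt0// => i _; rewrite subrr expr0n.
  by move/ca.
- move=> q /interior_subset[cq /= qs]; rewrite /b; case: asboolP => // _.
  rewrite /beta ler_pdivlMl ?mulr1; last by rewrite -invr_gt0.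
  by apply: flat1_homo; lra.
Qed.

(** A point of Z misses X or misses Y, so a bump for F or for G serves nearby. Asking for values at
    least 1 lets nonnegative bumps be added up with no partition of unity. *)
Lemma smooth_urysohn (X Y Z : set M) :
  closed X -> closed Y -> compact Z -> X `&` Y `&` Z = set0 ->
  exists F G : M -> R, [/\ Cc_infty S F, Cc_infty S G, (forall p, X p -> F p = 0),
    (forall p, Y p -> G p = 0) & forall p, Z p -> 1 <= F p + G p].
Proof.
move=> clX clY cZ XYZ.
pose P (V : set M) := exists F G : M -> R, [/\ Cc_infty S F /\ Cc_infty S G,
  (forall p, 0 <= F p) /\ (forall p, 0 <= G p), (forall p, X p -> F p = 0),
    (forall p, Y p -> G p = 0) & forall p, V p -> 1 <= F p + G p].
have cc0 := Cc_infty0 S.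
have [||p Zp|V ZV] := @compact_gluing M Z P cZ.
- by exists (fun=> 0), (fun=> 0).
- move=> A B [F [G [[cF cG] [F0 G0] XF YG FG]]] [F' [G' [[cF' cG'] [F0' G0'] XF' YG' FG']]].
  exists (fun p => F p + F' p), (fun p => G p + G' p); split.
  + by split; exact: Cc_infty_add.
  + by split=> p; rewrite addr_ge0.
  + by move=> p Xp; rewrite XF// XF'// addr0.
  + by move=> p Yp; rewrite YG// YG'// addr0.
  + move=> p [/FG|/FG']; have := F0 p; have := G0 p; have := F0' p; have := G0' p; lra.
- have [Xp|nXp] := pselect (X p).
    have nYp : (~` Y) p by move=> Yp; have : set0 p by rewrite -XYZ.
    have [b [U [cb b0 bV [oU Up] Ub]]] := exists_bump (closed_openC clY) nYp.
    exists U; split => //; exists (fun=> 0), b; split => //.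
      by move=> q Yq; apply: bV.
    by move=> q /Ub; rewrite add0r.
  have [b [U [cb b0 bV [oU Up] Ub]]] := exists_bump (closed_openC clX) nXp.
  exists U; split => //; exists b, (fun=> 0); split => //.
    by move=> q Xq; apply: bV.
  by move=> q /Ub; rewrite addr0.
- move=> [F [G [[cF cG] _ XF YG FG]]]; exists F, G; split => // p /ZV; exact: FG.
Qed.

End Bumps.

(** * Cuts of the line *)

Section Cuts.
Variable R : realType.
Implicit Types (x y d l a : R).

Definition soft_cut l a d x : R := l * soft d (x - a).

Lemma smooth_soft_cut l a d : smooth_on [set: R] (soft_cut l a d).
Proof.
have s1 := smooth_on_comp openT (smooth_soft d) (smooth_affine 1 (- a)).
apply: (smooth_on_eq openT _ (smooth_on_comp openT (smooth_affine l 0) s1)) => x _.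
by rewrite /soft_cut /= addr0 mul1r.
Qed.

Lemma derive1_soft_cut l a d x : (soft_cut l a d)^`()%classic x = l * (soft d)^`()%classic (x - a).
Proof.
have ds z : is_derive z (1 : R) (soft d) ((soft d)^`()%classic z).
  by apply: DeriveDef; [apply/smooth_derivable/smooth_soft|rewrite derive1E].
have da : is_derive x (1 : R) (fun x => x - a) 1.
  by apply: is_derive_eq; rewrite subr0.
rewrite derive1E; apply: derive_val; rewrite /soft_cut.
apply: is_derive_eq; rewrite /GRing.scale/=; ring.
Qed.

Lemma derive1_soft_cut_itv l a d x : 0 <= l -> 0 < d -> 0 <= (soft_cut l a d)^`()%classic x <= l.
Proof.
by move=> l0 d0; rewrite derive1_soft_cut; have := derive1_soft_itv (x - a) d0; nra.
Qed.

Lemma soft_cut_le0 l a d x : 0 < d -> x <= a -> soft_cut l a d x = 0.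
Proof. by move=> d0 xa; rewrite /soft_cut soft_le0 ?mulr0// subr_le0. Qed.

Lemma soft_cut_ge l a d x : 0 <= l -> 0 < d -> l * (x - a - d) <= soft_cut l a d x.
Proof. by move=> l0 d0; rewrite /soft_cut ler_wpM2l// soft_ge. Qed.

(** A smooth odd shrinkage: it approximates the identity with slope at most 1 and vanishes on
    [-d, d]. *)
Definition flatten0 d x : R := soft_cut 1 d d x - soft_cut 1 d d (- x).

Lemma derivable_soft_cut l a d x : derivable (soft_cut l a d) x 1.
Proof. exact/smooth_derivable/smooth_soft_cut. Qed.

Lemma smooth_flatten0 d : smooth_on [set: R] (flatten0 d).
Proof.
have s1 := smooth_on_comp openT (smooth_soft_cut 1 d d) (smooth_affine (-1) 0).
have s2 := smooth_on_comp openT (smooth_affine (-1) 0) s1.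
apply: (smooth_on_eq openT _ (smooth_on_add openT (smooth_soft_cut 1 d d) s2)) => x _.
by rewrite /flatten0 /= !addr0 !mulN1r.
Qed.

Lemma derive1_flatten0 d x :
  (flatten0 d)^`()%classic x = (soft_cut 1 d d)^`()%classic x + (soft_cut 1 d d)^`()%classic (- x).
Proof.
have ds z : is_derive z (1 : R) (soft_cut 1 d d) ((soft_cut 1 d d)^`()%classic z).
  by apply: DeriveDef; [exact: derivable_soft_cut|rewrite derive1E].
have da : is_derive x (1 : R) (fun x : R => - x) (-1) by exact: is_deriveNid.
rewrite derive1E; apply: derive_val; rewrite /flatten0.
apply: is_derive_eq; rewrite /GRing.scale/=; ring.
Qed.

Lemma derive1_flatten0_itv d x : 0 < d -> 0 <= (flatten0 d)^`()%classic x <= 1.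
Proof.
move=> d0; rewrite derive1_flatten0.
have [x0|x0] := leP x 0.
  rewrite (derive1_soft_cut _ _ _ x) (@derive1_soft_le0 _ _ (x - d)) ?mulr0 ?add0r//; last lra.
  exact: (derive1_soft_cut_itv d).
rewrite (derive1_soft_cut _ _ _ (- x)) (@derive1_soft_le0 _ _ (- x - d)) ?mulr0 ?addr0//; last lra.
exact: (derive1_soft_cut_itv d).
Qed.

Lemma derive1_flatten0_small d x : 0 < d -> `|x| <= d -> (flatten0 d)^`()%classic x = 0.
Proof.
move=> d0; rewrite ler_norml => /andP[x1 x2]; rewrite derive1_flatten0 !derive1_soft_cut.
rewrite (@derive1_soft_le0 _ _ (x - d))// ?subr_le0//.
by rewrite derive1_soft_le0 ?mulr0 ?addr0// subr_le0 lerNl.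
Qed.

Lemma flatten0_0 d : 0 < d -> flatten0 d 0 = 0.
Proof. by move=> d0; rewrite /flatten0 oppr0 subrr. Qed.

(** One d is lost to the shift of the threshold and at most one to its softening. *)
Lemma flatten0_close d x : 0 < d -> `|x - flatten0 d x| <= 2 * d.
Proof.
move=> d0; rewrite /flatten0 /soft_cut !mul1r ler_norml.
have H y : 0 <= y -> y - 2 * d <= soft d (y - d) <= y.
  move=> y0; have := soft_ge (y - d) d0; have [yd|yd] := leP y d.
    by rewrite (@soft_le0 _ _ (y - d))//; lra.
  by have := soft_le d0 (_ : 0 <= y - d); rewrite subr_ge0 (ltW yd) => /(_ isT); lra.
have [x0|x0] := leP x 0.
  have := H (- x); rewrite oppr_ge0 x0 => /(_ isT).
  by rewrite (@soft_le0 _ _ (x - d))//; lra.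
have := H x (ltW x0); by rewrite (@soft_le0 _ _ (- x - d))//; lra.
Qed.

(** A smooth stand-in for the indicator of |x| >= d; being 0 at 0, it preserves compact supports
    under composition. *)
Definition away0 d x : R := step (x / d) + step (- (x / d)).

Lemma smooth_away0 d : smooth_on [set: R] (away0 d).
Proof.
have s1 := smooth_on_comp openT (@smooth_step R) (smooth_affine d^-1 0).
have s2 := smooth_on_comp openT (@smooth_step R) (smooth_affine (- d^-1) 0).
apply: (smooth_on_eq openT _ (smooth_on_add openT s1 s2)) => x _.
by rewrite /away0 /= !addr0 mulNr mulrC.
Qed.

Lemma away0_0 d : away0 d 0 = 0.
Proof. by rewrite /away0 mul0r oppr0 step_le0 ?addr0. Qed.

Lemma away0_itv d x : 0 <= away0 d x <= 1.
Proof.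
rewrite /away0; have := step_itv (x / d); have := step_itv (- (x / d)).
have [y0|y0] := leP (x / d) 0; first by rewrite (step_le0 y0); lra.
by rewrite (@step_le0 _ (- (x / d))) ?oppr_le0 ?(ltW y0)//; lra.
Qed.

Lemma away0_far d x : 0 < d -> d <= `|x| -> away0 d x = 1.
Proof.
move=> d0; have [x0|x0] := ger0P x => dx; rewrite /away0.
  have xd : 1 <= x / d by rewrite ler_pdivlMr// mul1r.
  by rewrite step_ge1// step_le0 ?addr0//; lra.
have xd : 1 <= - (x / d) by rewrite -mulNr ler_pdivlMr// mul1r.
by rewrite (@step_ge1 _ (- _))// step_le0 ?add0r//; lra.
Qed.

Lemma le_mul_of_lt (a b p s : R) : 0 < a -> 0 < b -> 0 < p ->
  (forall e, 0 < e -> e < a -> e < b -> p * ((a - e) * (b - e)) <= s) ->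
  p * (a * b) <= s.
Proof.
move=> a0 b0 p0 H; rewrite leNgt; apply/negP => sab.
(* Shrinking both factors by e costs less than e p (a + b), so any e below this quotient contradicts
   the hypothesis. *)
have q0 : 0 < (p * (a * b) - s) / (p * (a + b)).
  by rewrite divr_gt0 ?subr_gt0// mulr_gt0// addr_gt0.
set q := (_ / _) in q0.
have qE : q * (p * (a + b)) = p * (a * b) - s.
  by rewrite divfK// gt_eqF// mulr_gt0// addr_gt0.
have m0 : 0 < Num.min q (Num.min a b) by rewrite !lt_min q0 a0 b0.
have mq : Num.min q (Num.min a b) <= q by rewrite ge_min lexx.
have ma : Num.min q (Num.min a b) <= a by rewrite !ge_min lexx orbT.
have mb : Num.min q (Num.min a b) <= b by rewrite !ge_min lexx !orbT.
pose e := Num.min q (Num.min a b) / 2.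
have eE : e * 2 = Num.min q (Num.min a b) by rewrite divfK.
have e3 : [/\ 0 < e, e < q, e < a & e < b].
  by clearbody e; move: m0 mq ma mb; rewrite -eE; split; lra.
have [e0 eq ea eb] := e3; have := H e e0 ea eb.
have : e * (p * (a + b)) < q * (p * (a + b)) by rewrite ltr_pM2r// mulr_gt0// addr_gt0.
rewrite qE; have : 0 < p * (e * e) by rewrite !mulr_gt0.
nra.
Qed.

End Cuts.

(** * The profile function and its lower bounds *)

Section Profile.
Variables (R : realType) (m : nat) (M : topologicalType) (S : smooth_manifold R m M).
Variable w : symplectic_form S.
Implicit Types (F G H K : M -> R) (FG HK : (M -> R) * (M -> R)) (r s t : R) (p : M).

Lemma derive_comp_fun (u : R -> R) F c x v : smooth_on [set: R] u -> smooth_fun S F ->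
  atlas S c -> cimg c x ->
  'D_v ((fun p => u (F p)) \o cinv c) x = u^`()%classic (F (cinv c x)) * 'D_v (F \o cinv c) x.
Proof.
move=> su sF Sc cx; rewrite (@derive_comp1 _ _ u (F \o cinv c))//.
  exact: smooth_fun_differentiable Sc sF cx.
exact: smooth_derivable.
Qed.

Lemma poisson_comp (u v : R -> R) F G p :
  smooth_on [set: R] u -> smooth_on [set: R] v -> smooth_fun S F -> smooth_fun S G ->
  poisson w (fun p => u (F p)) (fun p => v (G p)) p =
  u^`()%classic (F p) * v^`()%classic (G p) * poisson w F G p.
Proof.
move=> su sv sF sG.
rewrite (@poisson_jacobian _ _ _ _ w F G _ _ p (u^`()%classic (F p)) 0 0 (v^`()%classic (G p)))//.
- by rewrite mul0r subr0.
- exact: smooth_fun_comp.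
- exact: smooth_fun_comp.
- by move=> c x z Sc cx <-; rewrite derive_comp_fun// mul0r addr0.
- by move=> c x z Sc cx <-; rewrite derive_comp_fun// mul0r add0r.
Qed.

Lemma poissonC F G p : smooth_fun S F -> smooth_fun S G ->
  poisson w F G p = - poisson w G F p.
Proof.
move=> sF sG; rewrite (@poisson_jacobian _ _ _ _ w G F F G p 0 1 1 0)//; first by ring.
- by move=> c x u _ _ _; ring.
- by move=> c x u _ _ _; ring.
Qed.

Lemma dist_ge0 FG HK : 0 <= dist FG HK.
Proof. by rewrite addr_ge0 ?unorm_ge0. Qed.

Lemma profile_le FG HK s : KK w s HK -> profile w FG s <= dist FG HK.
Proof.
move=> sHK; apply: ge_inf; last by exists HK.
by exists 0 => _ [? _ <-]; exact: dist_ge0.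
Qed.

Lemma KK0 s : 0 <= s -> KK w s (fun=> 0, fun=> 0).
Proof.
move=> s0; split; first by split; exact: Cc_infty0.
apply: le_trans s0; rewrite unorm_le// => p /=.
have s00 := @smooth_fun_cst _ _ _ S (0 : R).
by rewrite poisson_eq0 ?normr0//; apply: nearW.
Qed.

Lemma profile_ge FG s r : 0 <= s ->
  (forall HK, KK w s HK -> r <= dist FG HK) -> r <= profile w FG s.
Proof.
move=> s0 H; apply: lb_le_inf; last by move=> _ [HK /H ? <-].
by exists (dist FG (fun=> 0, fun=> 0)), (fun=> 0, fun=> 0) => //; exact: KK0.
Qed.

Lemma profile_antitone FG s t : 0 <= s -> s <= t -> profile w FG t <= profile w FG s.
Proof.
move=> s0 st; apply: profile_ge => // HK [fHK sHK]; apply: profile_le.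
by split => //; exact: le_trans st.
Qed.

Lemma profile_swap F G s : profile w (F, G) s = profile w (G, F) s.
Proof.
rewrite /profile; congr inf.
have sw F' G' : [set dist (F', G') HK | HK in KK w s] `<=`
    [set dist (G', F') HK | HK in KK w s].
  move=> _ [[H K] [[/= cH cK] sHK] <-]; exists (K, H); last by rewrite /dist addrC.
  have E : unorm (poisson w K H) = unorm (poisson w H K).
    by apply: unormN => p; apply: poissonC; [case: cK|case: cH].
  by split; [split|rewrite /= E].
by apply/seteqP; split; exact: sw.
Qed.

Lemma dist_close FG HK p : FF S FG -> FF S HK ->
  `|FG.1 p - HK.1 p| <= unorm (FG.1 \- HK.1) /\ `|FG.2 p - HK.2 p| <= unorm (FG.2 \- HK.2).
Proof.
move=> [cF cG] [cH cK]; split.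
  by apply: (@le_unorm _ _ (FG.1 \- HK.1)); exact: Cc_infty_bounded (Cc_infty_sub cF cH).
by apply: (@le_unorm _ _ (FG.2 \- HK.2)); exact: Cc_infty_bounded (Cc_infty_sub cG cK).
Qed.

Lemma KK_poisson s HK p : KK w s HK -> `|poisson w HK.1 HK.2 p| <= s.
Proof. by move=> [[cH cK] sHK]; apply: le_trans sHK; exact: le_unorm_poisson. Qed.

(** Multiplying H by t/s = 1 - q carries a pair from bracket level s to level t and moves H by at
    most q times its norm, itself at most the norm of F plus the distance from F to H. *)
Lemma profile_scale FG s t : FF S FG -> 0 <= t -> t <= s -> 0 < s ->
  profile w FG t <= profile w FG s + (s - t) / s * (profile w FG s + unorm FG.1).
Proof.
move=> fFG t0 ts s0.
set q := (s - t) / s.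
have q0 : 0 <= q by rewrite divr_ge0 ?subr_ge0// ltW.
have qs : q * s = s - t by rewrite divfK// gt_eqF.
have q1 : q <= 1 by rewrite ler_pdivrMr// mul1r gerBl.
(* Solved for the profile at s, the claim becomes a lower bound on an infimum and can be tested on
   single pairs. *)
suff : (profile w FG t - q * unorm FG.1) / (1 + q) <= profile w FG s.
  by rewrite ler_pdivrMr; nra.
apply: profile_ge; first exact: ltW.
move=> HK sHK; rewrite ler_pdivrMr; last by lra.
have [fHK _] := sHK; have [cH cK] := fHK.
have cH' := Cc_infty_scale (1 - q) cH.
have tH : KK w t (fun p => (1 - q) * HK.1 p, HK.2).
  split; [by split|apply: unorm_le => // p /=].
  have -> : poisson w (fun p => (1 - q) * HK.1 p) HK.2 p = (1 - q) * poisson w HK.1 HK.2 p.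
    have [sH _] := cH; have [sK _] := cK; have [sH' _] := cH'.
    rewrite (@poisson_jacobian _ _ _ _ w HK.1 HK.2 _ _ p (1 - q) 0 0 1)//.
    - by rewrite mul0r subr0 mulr1.
    - move=> c x v Sc cx _; rewrite mul0r addr0.
      have dH := smooth_fun_differentiable Sc sH cx.
      have -> : (fun p => (1 - q) * HK.1 p) \o cinv c = (1 - q) *: (HK.1 \o cinv c) by [].
      by rewrite deriveZ//; exact: diff_derivable.
    - by move=> c x v Sc cx _; rewrite mul0r add0r mul1r.
  rewrite normrM ger0_norm ?subr_ge0//.
  have := KK_poisson p sHK; nra.
have := profile_le FG tH; rewrite /dist/=.
have H1 p : `|HK.1 p| <= unorm FG.1 + unorm (FG.1 \- HK.1).
  have [FH _] := dist_close p fFG fHK.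
  have : `|FG.1 p| <= unorm FG.1 by apply: le_unorm; apply: (@Cc_infty_bounded _ _ _ S); case: fFG.
  have := ler_normB (FG.1 p) (FG.1 p - HK.1 p).
  by rewrite (_ : FG.1 p - (FG.1 p - HK.1 p) = HK.1 p); [lra|ring].
have H2 : unorm (FG.1 \- (fun p => (1 - q) * HK.1 p)) <=
    unorm (FG.1 \- HK.1) + q * (unorm FG.1 + unorm (FG.1 \- HK.1)).
  have u1 := unorm_ge0 FG.1; have u2 := unorm_ge0 (FG.1 \- HK.1).
  apply: unorm_le => [|p]; first by rewrite addr_ge0// mulr_ge0// addr_ge0.
  have [FH _] := dist_close p fFG fHK.
  rewrite /= (_ : _ - _ = (FG.1 p - HK.1 p) + q * HK.1 p); last by ring.
  apply: le_trans (ler_normD _ _) _; rewrite lerD// normrM (ger0_norm q0).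
  exact: ler_wpM2l.
have := unorm_ge0 (FG.2 \- HK.2); nra.
Qed.

(** For t = 0 the ratio (s - t)/s is always 1, so rescaling says nothing at 0; there the hypothesis
    bounds the profile from below and monotonicity from above. *)
Lemma profile_continuous FG : FF S FG ->
  (forall e : R, 0 < e -> exists2 d : R, 0 < d &
     forall s, 0 <= s -> s < d -> profile w FG 0 - e < profile w FG s) ->
  {within [set s : R | 0 <= s], continuous (profile w FG)}.
Proof.
move=> fFG H0; apply/subspace_continuousP => s0 /= s00; apply/cvgrPdist_lt => e e0.
have [->|sn0] := eqVneq s0 0.
  have [d d0 Hd] := H0 e e0.
  rewrite near_withinE; near=> s => /= s1.
  have sd : s < d by near: s; exact: lt_nbhsl.
  have := Hd s s1 sd; have := profile_antitone FG (lexx 0) s1.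
  by move=> ? ?; rewrite ger0_norm; lra.
have {sn0}sp : 0 < s0 by rewrite lt_neqAle eq_sym sn0.
set C := profile w FG 0 + unorm FG.1.
have P0 s : 0 <= s -> 0 <= profile w FG s.
  by move=> s1; apply: profile_ge => // HK _; exact: dist_ge0.
have C0 : 0 <= C by rewrite addr_ge0 ?unorm_ge0 ?P0.
(* On either side of [s0] the larger argument is at least [s0], which bounds the denominator in the
   rescaling estimate. *)
have key a b : 0 <= a -> a <= b -> s0 <= b ->
    0 <= profile w FG a - profile w FG b <= (b - a) / s0 * C.
  move=> a0 ab sb; rewrite subr_ge0 profile_antitone//=.
  have b0 : 0 < b := lt_le_trans sp sb.
  have := profile_scale fFG a0 ab b0; rewrite -lerBlDl => /le_trans; apply.
  have bC : profile w FG b + unorm FG.1 <= C by rewrite lerD2r profile_antitone// ltW.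
  apply: ler_pM => //; rewrite ?divr_ge0 ?subr_ge0 ?addr_ge0 ?unorm_ge0 ?P0 ?(ltW b0)//.
  by rewrite ler_wpM2l ?subr_ge0// lef_pV2.
have d0 : 0 < e * s0 / (C + 1) by rewrite divr_gt0 ?mulr_gt0//; lra.
rewrite near_withinE; near=> s => /= s1.
have sd : `|s0 - s| < e * s0 / (C + 1) by near: s; exact: cvgr_dist_lt.
have lt_e : `|s0 - s| / s0 * C < e.
  move: sd; rewrite ltr_pdivlMr; last by lra.
  rewrite mulrAC ltr_pdivrMr//; have := normr_ge0 (s0 - s); nra.
suff : `|profile w FG s0 - profile w FG s| < e by [].
have [ss|ss] := leP s s0.
  have := key s s0 s1 ss (lexx _); move: lt_e; rewrite ger0_norm ?subr_ge0// => lt_e.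
  move=> /andP[k1 k2]; rewrite distrC ger0_norm ?subr_ge0//.
  exact: (le_lt_trans k2 lt_e).
have := key s0 s s00 (ltW ss) (ltW ss); move: lt_e; rewrite ltr0_norm ?subr_lt0// opprB => lt_e.
by move=> /andP[k1 k2]; rewrite ger0_norm//; exact: (le_lt_trans k2 lt_e).
Unshelve. all: by end_near. Qed.

(** Nonnegative thresholds make the cuts vanish at 0, hence keep supports compact. *)
Lemma poisson_soft_cut HK s (a b l n d : R) : KK w s HK -> 0 <= a -> 0 <= b -> 0 <= l -> 0 <= n ->
  0 < d ->
  FF S (fun p => soft_cut l a d (HK.1 p), fun p => soft_cut n b d (HK.2 p)) /\
  unorm (poisson w (fun p => soft_cut l a d (HK.1 p))
    (fun p => soft_cut n b d (HK.2 p))) <= l * n * s.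
Proof.
move=> sHK a0 b0 l0 n0 d0; have [[cH cK] us] := sHK.
have s0 : 0 <= s := le_trans (unorm_ge0 _) us.
split.
  by split; apply: Cc_infty_comp => //;
    [exact: smooth_soft_cut|exact: soft_cut_le0|exact: smooth_soft_cut|exact: soft_cut_le0].
apply: unorm_le => [|p]; first by rewrite !mulr_ge0.
rewrite poisson_comp; [|exact: smooth_soft_cut|exact: smooth_soft_cut|by case: cH|by case: cK].
have /andP[u0 u1] := derive1_soft_cut_itv a (HK.1 p) l0 d0.
have /andP[v0 v1] := derive1_soft_cut_itv b (HK.2 p) n0 d0.
rewrite normrM; apply: ler_pM (normr_ge0 _) (normr_ge0 _) _ (KK_poisson p sHK).
by rewrite normrM (ger0_norm u0) (ger0_norm v0); exact: ler_pM.
Qed.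

Lemma pb4_le X0 X1 Y0 Y1 FG : F4 S X0 X1 Y0 Y1 FG ->
  pb4 w X0 X1 Y0 Y1 <= unorm (poisson w FG.1 FG.2).
Proof.
move=> F4FG; apply: ge_inf; last by exists FG.
by exists 0 => _ [? _ <-]; exact: unorm_ge0.
Qed.

Lemma pb3_le X Y Z FG : F3 S X Y Z FG -> pb3 w X Y Z <= unorm (poisson w FG.1 FG.2).
Proof.
move=> F3FG; apply: ge_inf; last by exists FG.
by exists 0 => _ [? _ <-]; exact: unorm_ge0.
Qed.

Lemma profile_lower4 X0 X1 Y0 Y1 FG s : let q := pb4 w X0 X1 Y0 Y1 in 0 < q ->
  F4 S X0 X1 Y0 Y1 FG -> 0 <= s -> 1 / 2 - 1 / (2 * q) * s <= profile w FG s.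
Proof.
move=> q q0 [fFG [HX0 HX1 HY0 HY1]] s0; apply: profile_ge => // HK sHK.
have [fHK us] := sHK; rewrite /dist.
set a := unorm (FG.1 \- HK.1); set b := unorm (FG.2 \- HK.2).
have a0 : 0 <= a by exact: unorm_ge0.
have b0 : 0 <= b by exact: unorm_ge0.
have Ha p : `|FG.1 p - HK.1 p| <= a by case: (dist_close p fFG fHK).
have Hb p : `|FG.2 p - HK.2 p| <= b by case: (dist_close p fFG fHK).
have sq0 : 0 <= s / (2 * q) by rewrite divr_ge0// mulr_ge0// ltW.
have -> : 1 / (2 * q) * s = s / (2 * q) by rewrite div1r mulrC.
(* If a or b reaches 1/2, the distance alone exceeds the bound; otherwise both gaps stay positive
   and can be rescaled to 1. *)
have [a2|a2] := leP (1 / 2) a; first by lra.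
have [b2|b2] := leP (1 / 2) b; first by lra.
have ag : 0 < 1 - 2 * a by lra.
have bg : 0 < 1 - 2 * b by lra.
have : q * ((1 - 2 * a) * (1 - 2 * b)) <= s.
  apply: le_mul_of_lt => // d d0 da db.
  have l0 : 0 < (1 - 2 * a - d)^-1 by rewrite invr_gt0 subr_gt0.
  have n0 : 0 < (1 - 2 * b - d)^-1 by rewrite invr_gt0 subr_gt0.
  have [fc uc] := poisson_soft_cut sHK a0 b0 (ltW l0) (ltW n0) d0.
  have : q <= (1 - 2 * a - d)^-1 * (1 - 2 * b - d)^-1 * s.
    apply: le_trans uc; apply: (@pb4_le _ _ _ _ (_, _)); split => //; split => p /=.
    - move=> /HX0 Fp; rewrite soft_cut_le0//; have := Ha p; rewrite ler_norml; lra.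
    - move=> /HX1 Fp; apply: le_trans (soft_cut_ge _ _ (ltW l0) d0).
      rewrite ler_pdivlMl; last by rewrite subr_gt0.
      have := Ha p; rewrite ler_norml; lra.
    - move=> /HY0 Fp; rewrite soft_cut_le0//; have := Hb p; rewrite ler_norml; lra.
    - move=> /HY1 Fp; apply: le_trans (soft_cut_ge _ _ (ltW n0) d0).
      rewrite ler_pdivlMl; last by rewrite subr_gt0.
      have := Hb p; rewrite ler_norml; lra.
  rewrite -invfM mulrC ler_pdivlMr// mulr_gt0// subr_gt0//.
have -> : s / (2 * q) = s / q / 2 by field; rewrite gt_eqF.
rewrite mulrC -ler_pdivlMr// => H.
(* The product (1 - 2a)(1 - 2b) exceeds 1 - 2(a + b) by 4ab. *)
have := mulr_ge0 a0 b0; lra.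
Qed.

Lemma profile_lower3 X Y Z FG s : let q := pb3 w X Y Z in 0 < q ->
  F3 S X Y Z FG -> 0 <= s -> 1 / 2 - 1 / (2 * Num.sqrt q) * Num.sqrt s <= profile w FG s.
Proof.
move=> q q0 [fFG HX HY HZ] s0; apply: profile_ge => // HK sHK.
have [fHK us] := sHK; rewrite /dist.
set a := unorm (FG.1 \- HK.1); set b := unorm (FG.2 \- HK.2).
have a0 : 0 <= a by exact: unorm_ge0.
have b0 : 0 <= b by exact: unorm_ge0.
have Ha p : `|FG.1 p - HK.1 p| <= a by case: (dist_close p fFG fHK).
have Hb p : `|FG.2 p - HK.2 p| <= b by case: (dist_close p fFG fHK).
have rq0 : 0 < Num.sqrt q by rewrite sqrtr_gt0.
have -> : 1 / (2 * Num.sqrt q) * Num.sqrt s = Num.sqrt s / Num.sqrt q / 2.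
  by field; rewrite gt_eqF.
have r0 : 0 <= Num.sqrt s / Num.sqrt q by rewrite divr_ge0// sqrtr_ge0.
have [c0|c0] := leP (1 - 2 * (a + b)) 0; first by lra.
suff : 1 - 2 * (a + b) <= Num.sqrt s / Num.sqrt q by lra.
set c := 1 - 2 * (a + b) in c0 *.
have : q * (c * c) <= s.
  apply: le_mul_of_lt => // e e0 ec _.
  (* Both cuts lose their softness in the sum on Z, so each gets half of e. *)
  have d0 : 0 < e / 2 by rewrite divr_gt0.
  have l0 : 0 < (c - e)^-1 by rewrite invr_gt0 subr_gt0.
  have [fc uc] := poisson_soft_cut sHK a0 b0 (ltW l0) (ltW l0) d0.
  have : q <= (c - e)^-1 * (c - e)^-1 * s.
    apply: le_trans uc; apply: (@pb3_le _ _ _ (_, _)); split => // p /=.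
    - move=> /HX Fp; rewrite soft_cut_le0//; have := Ha p; rewrite ler_norml; lra.
    - move=> /HY Fp; rewrite soft_cut_le0//; have := Hb p; rewrite ler_norml; lra.
    - move=> /HZ Fp; apply: le_trans (lerD (soft_cut_ge _ _ (ltW l0) d0)
        (soft_cut_ge _ _ (ltW l0) d0)).
      rewrite -mulrDr ler_pdivlMl ?subr_gt0// mulr1 /c.
      have := Ha p; have := Hb p; rewrite !ler_norml; lra.
  rewrite -invfM mulrC ler_pdivlMr// mulr_gt0// subr_gt0//.
rewrite -expr2 => H; rewrite ler_pdivlMr//.
have : Num.sqrt (q * c ^+ 2) <= Num.sqrt s by rewrite ler_wsqrtr.
by rewrite sqrtrM ?(ltW q0)// sqrtr_sqr ger0_norm ?(ltW c0)// mulrC.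
Qed.

End Profile.

(** * The upper bound and the case p = 0 *)

Section UpperBound.
Variables (R : realType) (m : nat) (M : topologicalType) (S : smooth_manifold R m M).
Variable w : symplectic_form S.
Implicit Types (F G H K : M -> R) (FG : (M -> R) * (M -> R)) (r s t d : R) (p : M).

(* It equals 1/2 on the set |G| >= d, outside of which [flatten0 d \o G] is locally
   constant; hence the two functions Poisson-commute, and no cutoff of the
   constant 1/2 is needed on an open manifold. *)
Definition half_near d F G p : R := 2^-1 * (1 - (1 - away0 d (F p)) * (1 - away0 d (G p))).

Definition toward_half t d F G p : R := (1 - t) * F p + t * half_near d F G p.

Lemma smooth_toward_half t d F G :
  smooth_fun S F -> smooth_fun S G -> smooth_fun S (toward_half t d F G).
Proof.
move=> sF sG.
have sc H : smooth_fun S H -> smooth_fun S (fun p => 1 - away0 d (H p)).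
  move=> sH; have s1 := smooth_fun_comp (@smooth_away0 R d) sH.
  have := smooth_fun_comp (smooth_affine (-1) 1) s1.
  by congr (smooth_fun S _); apply/funext => p; rewrite mulN1r addrC.
have s1 := smooth_fun_mul (sc F sF) (sc G sG).
have s2 := smooth_fun_comp (smooth_affine (- (t * 2^-1)) (t * 2^-1)) s1.
have s3 := smooth_fun_add (smooth_fun_comp (smooth_affine (1 - t) 0) sF) s2.
move: s3; congr (smooth_fun S _); apply/funext => p.
rewrite /toward_half /half_near.
by move: (F p) (away0 d (F p)) (away0 d (G p)) => f x y; ring.
Qed.

Lemma Cc_toward_half t d F G :
  Cc_infty S F -> Cc_infty S G -> Cc_infty S (toward_half t d F G).
Proof.
move=> cF cG; pose h (x y : R) :=
  (1 - t) * x + t * (2^-1 * (1 - (1 - away0 d x) * (1 - away0 d y))).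
apply: (@Cc_infty_op _ _ _ _ h) => //; first by rewrite /h away0_0; ring.
by apply: smooth_toward_half; [case: cF|case: cG].
Qed.

(** If x = 1 the target is exactly 1/2, the midpoint of [0, 1]; otherwise both f and the target lie
    in [0, 1/2]. *)
Lemma dist_to_half (f x y : R) : 0 <= f <= 1 -> 0 <= x <= 1 -> 0 <= y <= 1 ->
  x = 1 \/ f <= 1 / 2 -> `|f - 2^-1 * (1 - (1 - x) * (1 - y))| <= 1 / 2.
Proof.
move=> /andP[f0 f1] /andP[x0 x1] /andP[y0 y1] xf.
have u0 : 0 <= (1 - x) * (1 - y) by rewrite mulr_ge0 ?subr_ge0.
have u1 : (1 - x) * (1 - y) <= 1 by rewrite mulr_ile1 ?subr_ge0 ?gerBl.
have ux : x = 1 -> (1 - x) * (1 - y) = 0 by move=> ->; rewrite subrr mul0r.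
move: ((1 - x) * (1 - y)) u0 u1 ux => u u0 u1 ux.
rewrite ler_norml; case: xf => [/ux ->|f2]; apply/andP; split; lra.
Qed.

(** Explains the factor in F of [half_near]: where G is small but F is large, the target must still
    be 1/2. *)
Lemma half_near_close d F G p : 0 < d -> d <= 1 / 2 -> 0 <= F p <= 1 ->
  `|F p - half_near d F G p| <= 1 / 2.
Proof.
move=> d0 d2 uF; have /andP[F0 _] := uF.
have ha := away0_itv d (F p); have hb := away0_itv d (G p).
apply: dist_to_half => //.
by have [Fd|Fd] := leP d (F p); [left; rewrite away0_far// ger0_norm|right;
  exact: le_trans (ltW Fd) d2].
Qed.

Lemma is_derive_blend (V : normedModType R) (f A B : V -> R) (x u : V) (t df dg a b : R) :
  is_derive x u f df -> is_derive x u A (a * df) -> is_derive x u B (b * dg) ->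
  is_derive x u (fun y => (1 - t) * f y + t * (2^-1 * (1 - (1 - A y) * (1 - B y))))
    (((1 - t) + t * (2^-1 * (a * (1 - B x)))) * df + (t * (2^-1 * ((1 - A x) * b))) * dg).
Proof.
move=> hf hA hB.
have h1 (H : V -> R) dH : is_derive x u H dH -> is_derive x u (fun y => 1 - H y) (- dH).
  move=> hH; have := is_deriveB (is_derive_cst (1 : R) x u) hH.
  by rewrite sub0r.
have h := is_deriveM (h1 _ _ hA) (h1 _ _ hB).
have {}h := is_deriveZ (t * 2^-1) (h1 _ _ h).
have {}h := is_deriveD (is_deriveZ (1 - t) hf) h.
have E : (fun y => (1 - t) * f y + t * (2^-1 * (1 - (1 - A y) * (1 - B y)))) =
   (1 - t) *: f + (t * 2^-1) *: (fun y => 1 - ((fun y => 1 - A y) * (fun y => 1 - B y)) y).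
  by apply/funext => y; rewrite mulrA.
rewrite E; apply: is_derive_eq.
by rewrite /GRing.scale/=; ring.
Qed.

(** Where |G| <= d the slope of [flatten0] is 0 and both sides vanish; elsewhere [away0] of G is 1,
    which removes the contribution of [half_near] to the dF coefficient. The dG coefficient drops
    out against a function of G. *)
Lemma poisson_toward_half t d F G p : 0 < d -> smooth_fun S F -> smooth_fun S G ->
  poisson w (toward_half t d F G) (fun q => flatten0 d (G q)) p =
  (1 - t) * (flatten0 d)^`()%classic (G p) * poisson w F G p.
Proof.
move=> d0 sF sG; have sk := @smooth_flatten0 R d; have sa := @smooth_away0 R d.
pose a (x y : R) := (1 - t) + t * (2^-1 * ((away0 d)^`()%classic x * (1 - away0 d y))).
pose b (x y : R) := t * (2^-1 * ((1 - away0 d x) * (away0 d)^`()%classic y)).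
rewrite (@poisson_jacobian _ _ _ _ w F G _ _ p (a (F p) (G p)) (b (F p) (G p)) 0
  ((flatten0 d)^`()%classic (G p)))//.
- rewrite mulr0 subr0 /a; have [Gd|Gd] := leP `|G p| d.
    by rewrite derive1_flatten0_small// !mulr0.
  by rewrite away0_far ?ltW// subrr !mulr0 addr0.
- exact: smooth_toward_half.
- exact: smooth_fun_comp.
- move=> c x u Sc cx <-; set q := cinv c x.
  have dF := smooth_fun_differentiable Sc sF cx.
  have dG := smooth_fun_differentiable Sc sG cx.
  have dsa H : smooth_fun S H -> is_derive x u (fun y => away0 d (H (cinv c y)))
      ((away0 d)^`()%classic (H q) * 'D_u (H \o cinv c) x).
    move=> sH; apply: DeriveDef; last exact: (derive_comp_fun _ sa sH Sc cx).
    apply: diff_derivable.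
    exact: smooth_fun_differentiable Sc (smooth_fun_comp sa sH) cx.
  have ddF : is_derive x u (F \o cinv c) ('D_u (F \o cinv c) x).
    by apply: derivableP; exact: diff_derivable.
  exact: (@derive_val _ _ _ _ _ _ _ (is_derive_blend t ddF (dsa F sF) (dsa G sG))).
- by move=> c x u Sc cx <-; rewrite (derive_comp_fun u sk sG Sc cx) mul0r add0r.
Qed.

Lemma profile_upper FG s : let N := unorm (poisson w FG.1 FG.2) in
  FF S FG -> unit_valued FG.1 -> 0 < N -> 0 <= s <= N ->
  profile w FG s <= 1 / 2 - 1 / (2 * N) * s.
Proof.
case: FG => F G /= fFG uF; set N := unorm _ => N0 /andP[s0 sN].
have [/= cF cG] := fFG; have [sF _] := cF; have [sG _] := cG.
(* Chosen so that the bracket bound (1 - t) N is exactly s. *)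
pose t := 1 - s / N.
have st : (1 - t) * N = s by rewrite /t opprB addrC subrK divfK// gt_eqF.
have t1 : 0 <= 1 - t by rewrite /t opprB addrC subrK divr_ge0// ltW.
have t0 : 0 <= t by rewrite /t subr_ge0 ler_pdivrMr// mul1r.
have -> : 1 / 2 - 1 / (2 * N) * s = t * (1 / 2) by rewrite /t; field; rewrite gt_eqF.
apply/ler_addgt0Pr => e e0.
(* The bound 1/2 serves the distance to F; e/2 absorbs the error 2d made on G. *)
pose d := Num.min (1 / 2) (e / 2).
have d2 : d <= 1 / 2 by rewrite ge_min lexx.
have de : 2 * d <= e by rewrite -ler_pdivlMl// mulrC ge_min lexx orbT.
have d0 : 0 < d by rewrite lt_min !divr_gt0.
have cH := Cc_toward_half t d cF cG.
have cK := Cc_infty_comp (@smooth_flatten0 R d) (flatten0_0 d0) cG.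
have sHK : KK w s (toward_half t d F G, fun q => flatten0 d (G q)).
  split; first by split.
  apply: unorm_le => // p /=; rewrite poisson_toward_half// normrM -st.
  apply: ler_pM => //; last exact: le_unorm_poisson.
  have /andP[k0 k1] := derive1_flatten0_itv (G p) d0.
  by rewrite ger0_norm ?mulr_ge0// ler_piMr.
apply: le_trans (profile_le (F, G) sHK) _; rewrite /dist/=; apply: lerD.
  apply: unorm_le => [|p]; first by rewrite mulr_ge0// divr_ge0.
  rewrite /= (_ : _ - _ = t * (F p - half_near d F G p)); last by rewrite /toward_half; ring.
  by rewrite normrM ger0_norm// ler_wpM2l// half_near_close.
apply: le_trans de; apply: unorm_le => [|p]; first by rewrite mulr_ge0// ltW.
exact: flatten0_close.
Qed.

Lemma profile_upper_flat FG s : let N := unorm (poisson w FG.1 FG.2) in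
  FF S FG -> unit_valued FG.1 \/ unit_valued FG.2 -> 0 < N -> 0 <= s <= N ->
  profile w FG s <= 1 / 2 - 1 / (2 * N) * s.
Proof.
case: FG => F G /= fFG [uF|uG]; first exact: (@profile_upper (F, G)).
have [/= cF cG] := fFG.
have -> : unorm (poisson w F G) = unorm (poisson w G F).
  by apply: unormN => p; apply: poissonC; [case: cF|case: cG].
by rewrite profile_swap; apply: (@profile_upper (G, F)); [split|exact: uG].
Qed.

(** The end common to k = 3 and k = 4: [phi] is the deficit in the lower bound. Its value at 0 pins
    the profile to 1/2, and its smallness near 0 gives continuity there. *)
Lemma profile_conclusions FG (phi : R -> R) :
  FF S FG -> unit_valued FG.1 \/ unit_valued FG.2 -> 0 < unorm (poisson w FG.1 FG.2) ->
  phi 0 = 0 -> (forall s, 0 <= s -> 1 / 2 - phi s <= profile w FG s) ->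
  (forall e : R, 0 < e -> exists2 d : R, 0 < d & forall s, 0 <= s -> s < d -> phi s < e) ->
  [/\ {within [set s : R | 0 <= s], continuous (profile w FG)},
      profile w FG 0 = 1 / 2 &
      forall s : R, 0 <= s <= unorm (poisson w FG.1 FG.2) ->
        profile w FG s <= 1 / 2 - 1 / (2 * unorm (poisson w FG.1 FG.2)) * s].
Proof.
move=> fFG uFG N0 phi0 low phi_small.
have up s (sN : 0 <= s <= unorm (poisson w FG.1 FG.2)) := profile_upper_flat fFG uFG N0 sN.
have P0 : profile w FG 0 = 1 / 2.
  apply/le_anti/andP; split; last by have := low 0 (lexx _); rewrite phi0 subr0.
  by have := up 0; rewrite mulr0 subr0 lexx (ltW N0) => /(_ isT).
split => //; apply: profile_continuous => // e e0.
have [d d0 Hd] := phi_small e e0; exists d => // s s0 sd; rewrite P0.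
have := low s s0; have := Hd s s0 sd; lra.
Qed.

End UpperBound.

(** * The case p = 0 *)

Section Flattening.
Variables (R : realType) (m : nat) (M : topologicalType) (S : smooth_manifold R m M).
Variable w : symplectic_form S.
Implicit Types (F G : M -> R) (FG : (M -> R) * (M -> R)) (s : R) (p : M).

Lemma profile_eq0 FG s : KK w s FG -> profile w FG s = 0.
Proof.
move=> sFG; have s0 : 0 <= s by case: sFG => _; exact: le_trans (unorm_ge0 _).
apply/le_anti/andP; split; last by apply: profile_ge => // HK _; exact: dist_ge0.
apply: le_trans (profile_le FG sFG) _; rewrite /dist.
have z (f : M -> R) : unorm (f \- f) <= 0.
  by rewrite unorm_le// => p /=; rewrite subrr normr0.
by rewrite -[leRHS]addr0 lerD.
Qed.

Lemma inf0_small (T : Type) (A : set T) (f : T -> R) (e : R) :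
  A !=set0 -> (forall x, 0 <= f x) -> inf [set f x | x in A] = 0 -> 0 < e ->
  exists2 x, A x & f x < e.
Proof.
move=> [x0 Ax0] f0 i0 e0.
have hi : has_inf [set f x | x in A].
  by split; [exists (f x0), x0|exists 0 => _ [x _ <-]].
have [_ [x Ax <-] fe] := inf_adherent e0 hi.
by exists x => //; rewrite i0 add0r in fe.
Qed.

Let C : R := Num.max 0 (sval (cid (derive1_step_bounded R))).

Let C0 : 0 <= C. Proof. by rewrite le_max lexx. Qed.

Let HC (x : R) : `|(@step R)^`()%classic x| <= C.
Proof. by rewrite le_max (svalP (cid (derive1_step_bounded R))) orbT. Qed.

Lemma flatten4 X0 X1 Y0 Y1 s : compact X0 -> compact X1 -> compact Y0 -> compact Y1 ->
  X0 `&` X1 = set0 -> Y0 `&` Y1 = set0 -> pb4 w X0 X1 Y0 Y1 = 0 -> 0 < s ->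
  exists FG, F4flat S X0 X1 Y0 Y1 FG /\ profile w FG s = 0.
Proof.
move=> cX0 cX1 cY0 cY1 X01 Y01 p0 s0.
have hM := hausdorffM S.
have ury (A B : set M) : compact A -> compact B -> A `&` B = set0 ->
    exists F, [/\ Cc_infty S F, (forall p, A p -> F p <= 0) & forall p, B p -> 1 <= F p].
  move=> cA cB AB.
  (* Taking the whole manifold as second set forces G = 0 and leaves an ordinary Urysohn
     function. *)
  have [|F [G [cF cG FA G0 FB]]] := smooth_urysohn S (compact_closed hM cA) (@closedT M) cB.
    by rewrite setIT.
  exists F; split => // p; first by move=> /FA ->.
  by move=> /FB; rewrite G0// addr0.
have [F [cF F0 F1]] := ury _ _ cX0 cX1 X01; have [G [cG G0 G1]] := ury _ _ cY0 cY1 Y01.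
have ne : F4 S X0 X1 Y0 Y1 !=set0 by exists (F, G); split; split.
(* Composing F with [step] multiplies the bracket by at most C; the added 1 keeps the denominator
   positive. *)
have e0 : 0 < s / (C + 1) by rewrite divr_gt0//; move: C0; lra.
have [[{}F {}G] [[/= {}cF {}cG] [{}F0 {}F1 {}G0 {}G1]] small] :=
  inf0_small ne (fun FG => unorm_ge0 (poisson w FG.1 FG.2)) p0 e0.
have cF' := Cc_infty_comp (@smooth_step R) (step_le0 (lexx 0)) cF.
have [sF _] := cF; have [sG _] := cG.
exists (fun p => step (F p), G); split.
  split; last by left => p; exact: step_itv.
  split; first by split.
  by split => //= p; [move=> /F0/step_le0 ->|move=> /F1/step_ge1 ->].
apply: profile_eq0; split; first by split.
apply: unorm_le => [|p] /=; first exact: ltW.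
rewrite (@poisson_jacobian _ _ _ _ w F G _ _ p ((@step R)^`()%classic (F p)) 0 0 1)//.
- rewrite mul0r subr0 mulr1 normrM.
  have := le_unorm_poisson w p cF cG; have := HC (F p).
  move: small; rewrite ltr_pdivlMr; last by move: C0; lra.
  move=> small h1 h2; apply: le_trans (ler_pM (normr_ge0 _) (normr_ge0 _) h1 h2) _.
  by have := unorm_ge0 (poisson w F G); move: small C0; nra.
- by case: cF'.
- by move=> c x u Sc cx <-; rewrite (derive_comp_fun u (@smooth_step R) sF Sc cx) mul0r addr0.
- by move=> c x u Sc cx _; rewrite mul0r mul1r add0r.
Qed.

Lemma flatten3 X Y Z s : compact X -> compact Y -> compact Z ->
  X `&` Y `&` Z = set0 -> pb3 w X Y Z = 0 -> 0 < s ->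
  exists FG, F3flat S X Y Z FG /\ profile w FG s = 0.
Proof.
move=> cX cY cZ XYZ p0 s0.
have hM := hausdorffM S.
have [F [G [cF cG F0 G0 FG1]]] :=
  smooth_urysohn S (compact_closed hM cX) (compact_closed hM cY) cZ XYZ.
have ne : F3 S X Y Z !=set0.
  by exists (F, G); split => //= p; [move=> /F0 ->|move=> /G0 ->].
(* The 4 is the product of the speed-up by 2 in u and the maximum 2 of a. *)
have e0 : 0 < s / (4 * C + 1) by rewrite divr_gt0//; move: C0; lra.
have [[{}F {}G] [[/= {}cF {}cG] {}F0 {}G0 {}FG1] small] :=
  inf0_small ne (fun FG => unorm_ge0 (poisson w FG.1 FG.2)) p0 e0.
have [sF _] := cF; have [sG _] := cG.
(* With u(F) = 1 for F >= 1/2 and a(F) = 2 for F <= 1/2, a(F) = 0 for F >= 1, the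
   pair (u(F), a(F) G) stays in F3, and its bracket is u'(F) a(F) {F, G}. *)
pose u (x : R) := step (2 * x + 0).
pose a (x : R) := -2 * step (2 * x + -1) + 2.
have su : smooth_on [set: R] u.
  exact: (smooth_on_comp openT (@smooth_step R) (smooth_affine 2 0)).
have sa : smooth_on [set: R] a.
  have s1 := smooth_on_comp openT (@smooth_step R) (smooth_affine 2 (-1)).
  exact: (smooth_on_comp openT (smooth_affine (-2) 2) s1).
have u0 : u 0 = 0 by rewrite /u mulr0 addr0 step_le0.
have du x : `|u^`()%classic x| <= 2 * C.
  have ds z : is_derive z (1 : R) (@step R) ((@step R)^`()%classic z).
    by apply: DeriveDef; [apply/smooth_derivable/smooth_step|rewrite derive1E].
  have dl : is_derive x (1 : R) (fun x => 2 * x + 0) 2.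
    by apply: is_derive_eq; rewrite /GRing.scale/=; ring.
  have -> : u^`()%classic x = 2 * (@step R)^`()%classic (2 * x + 0).
    rewrite derive1E; apply: derive_val; rewrite /u.
    by apply: is_derive_eq; rewrite /GRing.scale/=; ring.
  by rewrite normrM ger0_norm// ler_wpM2l.
have a_itv x : 0 <= a x <= 2.
  by rewrite /a; have /andP[? ?] := step_itv (2 * x + -1); apply/andP; split; lra.
have cF' := Cc_infty_comp su u0 cF.
have sG' : smooth_fun S (fun p => a (F p) * G p).
  exact: (smooth_fun_mul (smooth_fun_comp sa sF) sG).
have cG' : Cc_infty S (fun p => a (F p) * G p).
  by apply: (@Cc_infty_op _ _ _ _ (fun x y => a x * y)) => //; rewrite mulr0.
exists (fun p => u (F p), fun p => a (F p) * G p); split.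
  split; last by left => p; exact: step_itv.
  split => [||p Yp|p Zp] /=; first by split.
  - by move=> p Xp; rewrite /u step_le0// addr0; have := F0 p Xp; lra.
  - by have := G0 p Yp; have /andP[? _] := a_itv (F p); nra.
  (* For F >= 1 the pair is (1, 0); for 1/2 <= F < 1, u(F) = 1 and G >= 1 - F is positive; for F <
     1/2, G > 1/2 and is doubled. *)
  - have FG := FG1 p Zp; have /andP[ap _] := a_itv (F p).
    have [F1|F1] := leP 1 (F p).
      have aF : a (F p) = 0 by rewrite /a step_ge1; [ring|lra].
      by rewrite aF mul0r addr0 /u step_ge1//; lra.
    have [F2|F2] := leP (1 / 2) (F p).
      have uF : u (F p) = 1 by rewrite /u step_ge1//; lra.
      by rewrite uF lerDl mulr_ge0//; lra.
    have aF : a (F p) = 2 by rewrite /a step_le0; [ring|lra].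
    have /andP[uF _] := step_itv (2 * F p + 0).
    by rewrite aF /u; lra.
apply: profile_eq0; split; first by split.
apply: unorm_le => [|p] /=; first exact: ltW.
(* The Jacobian is triangular, so the coefficient a'(F) G does not enter the determinant. *)
rewrite (@poisson_jacobian _ _ _ _ w F G _ _ p (u^`()%classic (F p)) 0
  (a^`()%classic (F p) * G p) (a (F p)))//.
- rewrite mul0r subr0 !normrM.
  have h2 := le_unorm_poisson w p cF cG; have h1 := du (F p).
  have h3 : `|a (F p)| <= 2 by have /andP[? ?] := a_itv (F p); rewrite ger0_norm.
  move: small; rewrite ltr_pdivlMr; last by move: C0; lra.
  move=> small.
  have h13 := ler_pM (normr_ge0 _) (normr_ge0 _) h1 h3.
  have h := ler_pM (mulr_ge0 (normr_ge0 _) (normr_ge0 _)) (normr_ge0 _) h13 h2.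
  apply: le_trans h _.
  by have := unorm_ge0 (poisson w F G); move: small C0; nra.
- by case: cF'.
- by move=> c x v Sc cx <-; rewrite (derive_comp_fun v su sF Sc cx) mul0r addr0.
- move=> c x v Sc cx <-.
  have dG := smooth_fun_differentiable Sc sG cx.
  have da := smooth_fun_differentiable Sc (smooth_fun_comp sa sF) cx.
  have -> : (fun p => a (F p) * G p) \o cinv c =
    ((fun p => a (F p)) \o cinv c) * (G \o cinv c) by [].
  rewrite deriveM; [|exact: diff_derivable|exact: diff_derivable].
  by rewrite (derive_comp_fun v sa sF Sc cx) /GRing.scale/=; ring.
Qed.

End Flattening.

Theorem theorem1p4 (R : realType) (m : nat) (M : topologicalType)
    (S : smooth_manifold R m M) (w : symplectic_form S)
    (connM : connected [set: M]) :
  (forall X Y Z : set M,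
    compact X -> compact Y -> compact Z -> X `&` Y `&` Z = set0 ->
    let p := pb3 w X Y Z in
    (p = 0 -> forall s : R, 0 < s ->
      exists FG, F3flat S X Y Z FG /\ profile w FG s = 0) /\
    (0 < p -> forall FG, F3flat S X Y Z FG ->
      [/\ {within [set s : R | 0 <= s], continuous (profile w FG)},
          profile w FG 0 = 1 / 2,
          (forall s : R, 0 <= s <= unorm (poisson w FG.1 FG.2) ->
            profile w FG s <=
            1 / 2 - 1 / (2 * unorm (poisson w FG.1 FG.2)) * s) &
          (forall s : R, 0 <= s ->
            1 / 2 - 1 / (2 * Num.sqrt p) * Num.sqrt s <= profile w FG s)]))
  /\
  (forall X0 X1 Y0 Y1 : set M,
    compact X0 -> compact X1 -> compact Y0 -> compact Y1 ->
    X0 `&` X1 = set0 -> Y0 `&` Y1 = set0 ->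
    let p := pb4 w X0 X1 Y0 Y1 in
    (p = 0 -> forall s : R, 0 < s ->
      exists FG, F4flat S X0 X1 Y0 Y1 FG /\ profile w FG s = 0) /\
    (0 < p -> forall FG, F4flat S X0 X1 Y0 Y1 FG ->
      [/\ {within [set s : R | 0 <= s], continuous (profile w FG)},
          profile w FG 0 = 1 / 2,
          (forall s : R, 0 <= s <= unorm (poisson w FG.1 FG.2) ->
            profile w FG s <=
            1 / 2 - 1 / (2 * unorm (poisson w FG.1 FG.2)) * s) &
          (forall s : R, 0 <= s ->
            1 / 2 - 1 / (2 * p) * s <= profile w FG s)])).
Proof.
split=> [X Y Z cX cY cZ XYZ p|X0 X1 Y0 Y1 cX0 cX1 cY0 cY1 X01 Y01 p];
  split=> [p0 s s0|p0 FG [FGXY uFG]].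
- exact: flatten3.
- have fFG : FF S FG by case: FGXY.
  have low s := profile_lower3 p0 FGXY (s := s).
  have N0 : 0 < unorm (poisson w FG.1 FG.2) := lt_le_trans p0 (pb3_le w FGXY).
  have rp0 : 0 < Num.sqrt p by rewrite sqrtr_gt0.
  have [||cont rho0 up] := @profile_conclusions _ _ _ _ w FG
    (fun s => 1 / (2 * Num.sqrt p) * Num.sqrt s) fFG uFG N0 _ low.
  + by rewrite sqrtr0 mulr0.
  (* This is the point at which the deficit equals e. *)
  + move=> e e0; exists ((e * (2 * Num.sqrt p)) ^+ 2); first by rewrite exprn_gt0// !mulr_gt0.
    move=> s s0 sd; rewrite div1r mulrC ltr_pdivrMr ?mulr_gt0//.
    rewrite -[ltRHS]ger0_norm ?mulr_ge0 ?(ltW e0) ?(ltW rp0)//.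
    by rewrite -sqrtr_sqr ltr_sqrt// exprn_gt0// !mulr_gt0.
  by split.
- exact: (flatten4 cX0 cX1).
- have fFG : FF S FG by case: FGXY.
  have low s := profile_lower4 p0 FGXY (s := s).
  have N0 : 0 < unorm (poisson w FG.1 FG.2) := lt_le_trans p0 (pb4_le w FGXY).
  have [||cont rho0 up] := @profile_conclusions _ _ _ _ w FG
    (fun s => 1 / (2 * p) * s) fFG uFG N0 _ low.
  + by rewrite mulr0.
  + move=> e e0; exists (e * (2 * p)); first by rewrite !mulr_gt0.
    by move=> s s0 sd; rewrite div1r mulrC ltr_pdivrMr ?mulr_gt0.
  by split.
Qed.
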